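(* Let $\xi=(m_1,n_1)+(m_2,n_2)$ be a Newton polygon with $\lambda_2<1/2<\lambda_1$, and let $S=(\tilde S,\delta,\pi_0)$ be the arrowed binary sequence associated to the minimal ${\rm DM_1}$ $N_\xi$. Let $m_1<i\le n_1$ and $1\le j\le m_2$, let $\pi$ be the small modification of $\pi_0$ by $0^A_i$ and $1^B_j$, and let $S'=(\tilde S',\delta,\pi)$ be the specialization of $S$ obtained by exchanging $0^A_i$ and $1^B_j$. Then $\ell(S')=\ell(S)-1$ holds if and only if there exists no non-negative integer $n$ such that $\mathcal A^{(n)}$ contains the inverse image $\pi^{-1}(1^B_j)$ or $\mathcal B^{(n)}$ contains the inverse image $\pi^{-1}(0^A_i)$.
   Context: $(m_1,n_1),(m_2,n_2)$ are pairs of coprime non-negative integers, $h_r=m_r+n_r$, $\lambda_r=n_r/h_r$. An arrowed binary sequence (ABS) is a triple $(\tilde T,\delta,\pi)$ of a finite totally ordered set $\tilde T$, a map $\delta:\tilde T\to\{0,1\}$ and a bijection $\pi:\tilde T\to\tilde T$; its length is $\ell=\#\{(t',t): t'<t,\ \delta(t')=0,\ \delta(t)=1\}$. $A=(\tilde A,\delta,\pi_A)$ is the ABS with $\tilde A=\{\tau^A_1<\dots<\tau^A_{h_1}\}$, $\delta(\tau^A_x)=1$ for $x\le m_1$, $\delta(\tau^A_x)=0$ for $x>m_1$, $\pi_A(\tau^A_x)=\tau^A_{x-m_1\bmod h_1}$; $B=(\tilde B,\delta,\pi_B)$ is defined likewise from $(m_2,n_2)$. The $x$-th element of $\tilde A$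 is written $1^A_x$ or $0^A_x$ according to its $\delta$-value, similarly for $B$. The ABS $S=A\oplus B=(\tilde S,\delta,\pi_0)$ associated to $N_\xi$ (the Dieudonné module of the $p$-kernel of the minimal $p$-divisible group of $\xi$) has $\tilde S=\tilde A\sqcup\tilde B$, $\pi_0=\pi_A\sqcup\pi_B$, and order $1^A_1\cdots1^A_{m_1}\,0^A_{m_1+1}\cdots0^A_{n_1}\,1^B_1\cdots1^B_{n_2}\,0^A_{n_1+1}\cdots0^A_{h_1}\,1^B_{n_2+1}\cdots1^B_{m_2}\,0^B_{m_2+1}\cdots0^B_{h_2}$ (increasing from left to right). The small modification $\pi$ of $\pi_0$ by $0^A_i,1^B_j$ is defined by $\pi(\pi_0^{-1}(0^A_i))=1^B_j$, $\pi(\pi_0^{-1}(1^B_j))=0^A_i$, and $\pi=\pi_0$ elsewhere. The specialization $S'=(\tilde S',\delta,\pi)$ has $\tilde S'=\tilde S$ as a set, with the ordering $<'$ characterized by: (i) $t<'t'$ implies $b(t)\le b(t')$, where $b(t)=0.b_1b_2\cdots$ (binary) with $b_x=\delta(\pi^{-x}(t))$; (ii) if $\delta(t)=\delta(t')$ then $t<'t'\iff\pi(t)<'\pi(t')$. Sets $\mathcal A^{(n)}$. $S^{(0)}$ is the set $\tilde S$ with the order obtained from that of $\tilde S$ by interchanging the positions of $0^A_i$ and $1^B_j$. Put $\alpha_n=\pi^n(0^A_i)$. Define inductively $\mathcal A^{(n)}=\{t\in\tilde A: \delta(t)=\delta(\alpha_n),\ t<\alpha_n \text{ and } \alpha_{n+1}<\pi(t)\text{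 in }S^{(n)}\}$; if $\mathcal A^{(n-1)}\ne\emptyset$ ($n\ge1$), $S^{(n)}$ is obtained from $S^{(n-1)}$ by moving $\alpha_n$ to the place immediately to the right of $\pi(t_{\max})$, where $t_{\max}$ is the maximum element of $\mathcal A^{(n-1)}$, keeping the relative order of the other elements. The construction stops at the smallest $a\ge0$ with $\mathcal A^{(a)}=\emptyset$ (such $a$ exists). Sets $\mathcal B^{(n)}$. Put $\beta_n=\pi^n(1^B_j)$. Define inductively $\mathcal B^{(n)}=\{t\in\tilde S:\delta(t)=\delta(\beta_n),\ \beta_n<t\text{ and }\pi(t)<\beta_{n+1}\text{ in }S^{(a+n)}\}$ for $n\ge0$; if $\mathcal B^{(n-1)}\ne\emptyset$ ($n\ge1$), $S^{(a+n)}$ is obtained from $S^{(a+n-1)}$ by moving $\beta_n$ to the place immediately to the left of $\pi(t_{\min})$, where $t_{\min}$ is the minimum element of $\mathcal B^{(n-1)}$, keeping the relative order of the other elements. The construction stops at the first $n$ with $\mathcal B^{(n)}=\emptyset$, if there is one. The statement quantifies over those $n$ for which the sets are defined. *)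

(* Defs.v *)
From mathcomp Require Import all_boot all_order all_algebra fingroup perm.
From mathcomp Require Import classical_sets reals topology normedtype sequences.

Set Implicit Arguments.
Unset Strict Implicit.
Unset Printing Implicit Defensive.

Import Order.TTheory GRing.Theory Num.Theory numFieldNormedType.Exports.

Local Open Scope nat_scope.

(** A total order on the finite type [T] is given by the increasing enumeration
    [s] of [T] (every element occurs exactly once in [s]). *)
Definition before (T : eqType) (s : seq T) (t t' : T) : bool :=
  index t s < index t' s.

Definition insert_at (T : Type) (k : nat) (x : T) (s : seq T) : seq T :=
  take k s ++ x :: drop k s.

(** [x] is moved immediately to the right (resp. left) of [y]; meant for [x != y]. *)
Definition move_right_of (T : eqType) (x y : T) (s : seq T) : seq T :=
  insert_at (index y (rem x s)).+1 x (rem x s).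

Definition move_left_of (T : eqType) (x y : T) (s : seq T) : seq T :=
  insert_at (index y (rem x s)) x (rem x s).

(** Arrowed binary sequences with underlying set [T]; [abs_delta t = true]
    stands for delta(t) = 1. *)
Record ABS (T : finType) := MkABS {
  abs_order : seq T;
  abs_orderP : perm_eq abs_order (enum T);
  abs_delta : T -> bool;
  abs_pi : {perm T} }.

Definition abs_lt (T : finType) (S : ABS T) : rel T := before (abs_order S).

Definition abs_length (T : finType) (S : ABS T) : nat :=
  #|[set p : T * T | [&& abs_lt S p.1 p.2,
                         abs_delta S p.1 == false & abs_delta S p.2 == true]]|.

(** The ABS attached to a pair (m, n), with h = m + n.  The element tau_x
    (1 <= x <= h) is the ordinal of value x - 1, and x - m = x + n mod h. *)
Definition pair_delta (m n : nat) (k : 'I_(m + n)) : bool := k < m.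

Definition pair_pi_fun (m n : nat) (k : 'I_(m + n)) : 'I_(m + n) :=
  Ordinal (ltn_pmod (k + n) (leq_ltn_trans (leq0n k) (ltn_ord k))).

Lemma pair_pi_inj (m n : nat) : injective (@pair_pi_fun m n).
Proof.
move=> k l /(congr1 val) /= /eqP; rewrite eqn_modDr.
by rewrite !modn_small ?ltn_ord // => /eqP; apply: val_inj.
Qed.

Definition pair_ABS (m n : nat) : ABS 'I_(m + n) :=
  MkABS (perm_refl (enum 'I_(m + n))) (@pair_delta m n) (perm (@pair_pi_inj m n)).

Definition sum_delta (T1 T2 : finType) (A : ABS T1) (B : ABS T2)
    (t : T1 + T2) : bool :=
  match t with inl x => abs_delta A x | inr y => abs_delta B y end.

Definition sum_pi_fun (T1 T2 : finType) (A : ABS T1) (B : ABS T2)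
    (t : T1 + T2) : T1 + T2 :=
  match t with inl x => inl (abs_pi A x) | inr y => inr (abs_pi B y) end.

Lemma sum_pi_inj (T1 T2 : finType) (A : ABS T1) (B : ABS T2) :
  injective (sum_pi_fun A B).
Proof. by move=> [x|x] [y|y] //= [] /perm_inj ->. Qed.

(** The order of A (+) B: the first n1 elements of A, the first n2 elements of B,
    the rest of A, the rest of B. *)
Definition min_order (m1 n1 m2 n2 : nat) : seq ('I_(m1 + n1) + 'I_(m2 + n2)) :=
  let sA := abs_order (pair_ABS m1 n1) in
  let sB := abs_order (pair_ABS m2 n2) in
  [seq inl x | x <- take n1 sA] ++ [seq inr y | y <- take n2 sB]
  ++ [seq inl x | x <- drop n1 sA] ++ [seq inr y | y <- drop n2 sB].

Lemma min_orderP (m1 n1 m2 n2 : nat) :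
  perm_eq (min_order m1 n1 m2 n2) (enum {: 'I_(m1 + n1) + 'I_(m2 + n2)}).
Proof.
rewrite enumT unlock /= /sum_enum -!enumT /min_order /=.
rewrite -{3}(cat_take_drop n1 (enum _)) -{3}(cat_take_drop n2 (enum 'I_(m2 + n2))).
by rewrite !map_cat -!catA perm_cat2l perm_catCA.
Qed.

Definition min_ABS (m1 n1 m2 n2 : nat) : ABS ('I_(m1 + n1) + 'I_(m2 + n2))%type :=
  MkABS (min_orderP m1 n1 m2 n2)
        (sum_delta (pair_ABS m1 n1) (pair_ABS m2 n2))
        (perm (@sum_pi_inj _ _ (pair_ABS m1 n1) (pair_ABS m2 n2))).

(** Products of permutations are composed from left to right. *)
Definition small_mod (T : finType) (pi0 : {perm T}) (a b : T) : {perm T} :=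
  (pi0 * tperm a b)%g.

Lemma small_modL (T : finType) (pi0 : {perm T}) (a b : T) :
  small_mod pi0 a b ((pi0^-1)%g a) = b.
Proof. by rewrite permM permKV tpermL. Qed.

Lemma small_modR (T : finType) (pi0 : {perm T}) (a b : T) :
  small_mod pi0 a b ((pi0^-1)%g b) = a.
Proof. by rewrite permM permKV tpermR. Qed.

Lemma small_modD (T : finType) (pi0 : {perm T}) (a b t : T) :
  t != (pi0^-1)%g a -> t != (pi0^-1)%g b -> small_mod pi0 a b t = pi0 t.
Proof.
move=> ta tb; rewrite permM tpermD // eq_sym.
  by apply: contra ta => /eqP <-; rewrite permK.
by apply: contra tb => /eqP <-; rewrite permK.
Qed.

Definition binary_expansion (R : realType) (T : finType)
    (delta : T -> bool) (pi : {perm T}) (t : T) : R :=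
  limn (fun N : nat =>
    \sum_(1 <= x < N) (delta ((pi ^- x)%g t))%:R / 2 ^+ x : R)%R.

(** [S'] is the specialization of [S] for the small modification [pi]. *)
Definition is_specialization (R : realType) (T : finType)
    (S : ABS T) (pi : {perm T}) (S' : ABS T) : Prop :=
  [/\ abs_delta S' = abs_delta S,
      abs_pi S' = pi,
      forall t t', abs_lt S' t t' ->
        (binary_expansion R (abs_delta S) pi t
           <= binary_expansion R (abs_delta S) pi t')%R
    & forall t t', abs_delta S t = abs_delta S t' ->
        abs_lt S' t t' = abs_lt S' (pi t) (pi t')].

(** The sets A^(n), B^(n).  Here [S] is an ABS with underlying set the disjoint
    union of [T1] (the set underlying A) and [T2], and [a], [b] are the elements
    0^A_i, 1^B_j.  An object is [None] when it is not defined. *)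
Section Stages.

Variables (T1 T2 : finType) (S : ABS (T1 + T2)%type) (a b : (T1 + T2)%type).

Local Notation T := (T1 + T2)%type.
Local Notation delta := (abs_delta S).
Local Notation pi := (small_mod (abs_pi S) a b).

Definition alpha (n : nat) : T := (pi ^+ n)%g a.
Definition beta (n : nat) : T := (pi ^+ n)%g b.

Definition setA_in (s : seq T) (n : nat) : {set T} :=
  [set t : T | [&& is_inl t, delta t == delta (alpha n),
                   before s t (alpha n) & before s (alpha n.+1) (pi t)]].

Definition setB_in (s : seq T) (n : nat) : {set T} :=
  [set t : T | [&& delta t == delta (beta n),
                   before s (beta n) t & before s (pi t) (beta n.+1)]].

Definition max_in (s : seq T) (X : {set T}) : option T :=
  ohead (rev [seq t <- s | t \in X]).

Definition min_in (s : seq T) (X : {set T}) : option T :=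
  ohead [seq t <- s | t \in X].

(** S^(n). *)
Fixpoint stageA (n : nat) : option (seq T) :=
  match n with
  | 0 => Some [seq tperm a b t | t <- abs_order S]
  | n'.+1 =>
      if stageA n' is Some s then
        if max_in s (setA_in s n') is Some tmax
        then Some (move_right_of (alpha n) (pi tmax) s)
        else None
      else None
  end.

Definition calA (n : nat) : option {set T} :=
  omap (fun s => setA_in s n) (stageA n).

(** S^(c + n), where c is the integer at which the construction of the sets
    A^(n) stops, that is, the unique c for which A^(c) is defined and empty. *)
Fixpoint stageB (c n : nat) : option (seq T) :=
  match n with
  | 0 => if calA c == Some finset.set0 then stageA c else None
  | n'.+1 =>
      if stageB c n' is Some s then
        if min_in s (setB_in s n') is Some tmin
        then Some (move_left_of (beta n) (pi tmin) s)
        else None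
      else None
  end.

Definition calB (c n : nat) : option {set T} :=
  omap (fun s => setB_in s n) (stageB c n).

Definition in_calA (n : nat) (t : T) : Prop :=
  exists2 X, calA n = Some X & t \in X.

Definition in_calB (n : nat) (t : T) : Prop :=
  exists c, exists2 X, calB c n = Some X & t \in X.

End Stages.

Definition slope (m n : nat) : rat := (n%:R / (m + n)%:R)%R.

(* Main.v *)
Require Import Defs.
From mathcomp Require Import all_boot all_order all_algebra fingroup perm reals.
From mathcomp Require Import boolp classical_sets topology normedtype sequences.
From mathcomp Require Import zify lra.

(* Compare elements by their forward words delta(t) delta(pi t) delta(pi^2 t)...
   Let G(x, y) be 1, -1 or 0 according to whether the word of x is smaller than,
   larger than or equal to that of y.  Reindexing the sum over all pairs of
   (sign of the order) * G by pi, once for the order of S' and once for the order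
   of S with a = 0_i and b = 1_j interchanged, gives
     l(S') = l(S) - 1 - sum over a < t < b of (G(a, t) + G(t, b)),
   where every term is nonnegative.  So l(S') = l(S) - 1 iff, in words, z < a for
   all zeros z and b < w for all ones w strictly between a and b.

   In S^(n) the only pairs x < y with equal digits whose images are in the wrong
   order are the (t, alpha_n) with t in A^(n), and the (b, w).  Hence A^(n) consists
   of the pi^n(z) for which z and a have the same digits at the places 0, ..., n;
   dually for B^(n).  So "no hit" says that a difference of digits occurs before
   the orbit of z (of w) leaves its component, and then it has the right sign
   because the order of A (of B) is compatible with pi_0.  Conversely, a hit
   together with the word inequalities makes the word of some 1_x^B, x <= j,
   smaller than that of an element of A.  This is impossible: in A every 1 is
   followed by a 0, in B every 0 is followed by a 1, so the two words alternate
   1010... until one of the orbits reaches pi^-1(b) or pi^-1(a), where one of the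
   word inequalities applies. *)

Set Implicit Arguments.
Unset Strict Implicit.
Unset Printing Implicit Defensive.

Import Order.TTheory GRing.Theory Num.Theory.

Local Open Scope nat_scope.

(** * Total orders given by enumerations *)

Definition strict_total (T : Type) (lt : rel T) : Prop :=
  [/\ irreflexive lt, transitive lt & forall x y, x <> y -> lt x y || lt y x].

Lemma strict_total_asym (T : Type) (lt : rel T) x y :
  strict_total lt -> lt x y -> lt y x = false.
Proof.
case=> irr tr _ xy; apply/negP => yx.
by have := tr _ _ _ xy yx; rewrite irr.
Qed.

Lemma strict_totalNlt (T : Type) (lt : rel T) x y :
  strict_total lt -> x <> y -> lt x y = false -> lt y x.
Proof. by case=> _ _ tot /tot /orP[->|->]. Qed.

Lemma strict_total_rev (T : Type) (lt : rel T) :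
  strict_total lt -> strict_total (fun x y => lt y x).
Proof.
case=> irr tr tot; split=> [x|y x z xy yz|x y /tot].
- exact: irr.
- exact: tr yz xy.
- by rewrite orbC.
Qed.

Lemma strict_total_before (T : eqType) (s : seq T) :
  (forall x, x \in s) -> strict_total (before s).
Proof.
rewrite /before => sT; split=> [x|y x z|x y xy]; first exact: ltnn.
  exact: ltn_trans.
rewrite -neq_ltn; apply/eqP => e; apply: xy.
by rewrite -(nth_index x (sT x)) e nth_index.
Qed.

(** * Insertion, removal and moves in an enumeration *)

Section InsertAt.
Variables (T : eqType) (s : seq T).

Lemma index_insert_at k x u : u != x -> k <= size s ->
  index u (insert_at k x s) = index u s + (k <= index u s).
Proof.
move=> ux ks; rewrite /insert_at -{3 4}(cat_take_drop k s) !index_cat /= eq_sym.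
rewrite (negbTE ux) size_takel //; case: ifP => us.
  have := us; rewrite -index_mem size_takel // => lt.
  by rewrite leqNgt lt addn0.
by rewrite leq_addr addn1 addnS.
Qed.

Lemma index_insert_at_same k x : x \notin s -> k <= size s ->
  index x (insert_at k x s) = k.
Proof.
move=> xs ks; rewrite /insert_at index_cat.
by rewrite (negbTE (contra (@mem_take _ _ _ _) xs)) /= eqxx addn0 size_takel.
Qed.

Lemma insert_at_rem x : x \in s -> insert_at (index x s) x (rem x s) = s.
Proof.
move=> xs; rewrite /insert_at remE take_cat drop_cat size_take.
rewrite -(index_mem x s) in xs; rewrite xs ltnn subnn take0 drop0 cats0.
by rewrite -[X in _ ++ X :: _](nth_index x (s := s)) -?index_mem // -drop_nth ?cat_take_drop.
Qed.

End InsertAt.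

Section Rem.
Variables (T : eqType) (s : seq T).
Hypothesis us : uniq s.

(** By [insert_at_rem], [s] is an insertion of [x] into [rem x s], and an insertion does not change
    the comparison of two other elements. *)
Lemma before_rem x u v : x \in s -> u != x -> v != x ->
  before (rem x s) u v = before s u v.
Proof.
move=> xs ux vx; rewrite /before -[in RHS](insert_at_rem xs).
have ks : index x s <= size (rem x s).
  by rewrite size_rem // -ltnS prednK ?index_mem //; case: (s) xs.
rewrite !index_insert_at //; lia.
Qed.

Lemma perm_insert_at k x (r : seq T) : perm_eq (insert_at k x r) (x :: r).
Proof. by rewrite /insert_at perm_catC /= perm_cons perm_catC cat_take_drop. Qed.

Lemma perm_move_right_of x y : x \in s -> perm_eq (move_right_of x y s) s.
Proof.
move=> xs; apply: perm_trans (perm_insert_at _ _ _) _.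
by rewrite perm_sym; exact: perm_to_rem.
Qed.

Lemma perm_move_left_of x y : x \in s -> perm_eq (move_left_of x y s) s.
Proof.
move=> xs; apply: perm_trans (perm_insert_at _ _ _) _.
by rewrite perm_sym; exact: perm_to_rem.
Qed.
End Rem.

Section MoveBefore.
Variables (T : eqType) (s : seq T) (x y : T).
Hypotheses (us : uniq s) (xs : x \in s) (ys : y \in s) (xy : y != x).

Let yr : index y (rem x s) < size (rem x s).
Proof. by rewrite index_mem mem_rem_uniq // !inE xy. Qed.

Let xr : x \notin rem x s.
Proof. by rewrite mem_rem_uniq // !inE eqxx. Qed.

Lemma before_move u v : u != x -> v != x ->
  (before (move_right_of x y s) u v = before s u v) *
  (before (move_left_of x y s) u v = before s u v).
Proof.
move=> ux vx; rewrite -(before_rem us xs ux vx) /before /move_right_of /move_left_of.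
by have yr' := ltnW yr; split; rewrite !index_insert_at //; lia.
Qed.

(** Nothing lies between [y] and the moved [x], so [x] precedes exactly what [y] preceded; for
    [v = y] both sides are false. *)
Lemma before_move_right_ofl v : v != x -> v \in s ->
  before (move_right_of x y s) x v = before s y v.
Proof.
move=> vx vs; rewrite -(before_rem us xs xy vx) /before /move_right_of.
by rewrite index_insert_at_same // index_insert_at //; lia.
Qed.

Lemma before_move_left_ofr u : u != x -> u \in s ->
  before (move_left_of x y s) u x = before s u y.
Proof.
move=> ux us'; rewrite -(before_rem us xs ux xy) /before /move_left_of.
have yr' := ltnW yr.
by rewrite index_insert_at_same // index_insert_at //; lia.
Qed.
End MoveBefore.

Lemma index_rev (T : eqType) (s : seq T) z :
  uniq s -> z \in s -> index z (rev s) = size s - (index z s).+1.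
Proof.
rewrite -index_mem => us zs.
have zn : size s - (index z s).+1 < size s by lia.
have {1}-> : z = nth z (rev s) (size s - (index z s).+1).
  rewrite nth_rev // (_ : size s - _ = index z s) ?nth_index // -?index_mem //; lia.
by rewrite index_uniq ?rev_uniq ?size_rev.
Qed.

Lemma before_rev (T : eqType) (s : seq T) x y :
  uniq s -> x \in s -> y \in s -> before (rev s) x y = before s y x.
Proof.
move=> us xs ys; rewrite /before !index_rev //.
move: xs ys; rewrite -!index_mem; lia.
Qed.

(** * Least and greatest elements of a set in an enumeration *)

Section Extrema.
Variables (T1 T2 : finType).
Local Notation T := (T1 + T2)%type.

Lemma min_inP (s : seq T) (X : {set T}) : uniq s -> (forall x, x \in s) ->
  match min_in s X with
  | Some m => m \in X /\ forall t, t \in X -> t = m \/ before s m t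
  | None => X = finset.set0 end.
Proof.
move=> us sT; rewrite /min_in; case e : [seq _ <- _ | _] => [|m r] /=.
  apply/setP => t; rewrite inE; apply/negP => tX.
  by have := mem_filter (mem X) t s; rewrite e sT /= tX.
have : m \in [seq t <- s | t \in X] by rewrite e mem_head.
rewrite mem_filter => /andP[mX _]; split=> // t tX.
case: (eqVneq t m) => [->|tm]; [by left|right].
have [_ _ tot] := strict_total_before sT.
case/orP: (tot m t (fun h => negP tm (introT eqP (esym h)))) => // tm'.
have st : sorted (before s) [seq t <- s | t \in X].
  apply: sorted_filter; first by case: (strict_total_before sT).
  apply/(sortedP m) => k ks; rewrite /before !index_uniq //; exact: ltn_trans ks.
move: st; rewrite e /= => /(order_path_min _)-/(_ (let: And3 _ h _ := strict_total_before sT in h)).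
have tr : t \in r.
  have : t \in m :: r by rewrite -e mem_filter tX sT.
  by rewrite inE (negbTE tm).
by move=> /allP/(_ _ tr).
Qed.

Lemma max_inP (s : seq T) (X : {set T}) : uniq s -> (forall x, x \in s) ->
  match max_in s X with
  | Some m => m \in X /\ forall t, t \in X -> t = m \/ before s t m
  | None => X = finset.set0 end.
Proof.
move=> us sT; have sT' x : x \in rev s by rewrite mem_rev.
have us' : uniq (rev s) by rewrite rev_uniq.
have := min_inP X us' sT'; rewrite /max_in /min_in -filter_rev.
case: ohead => // m [mX h]; split=> // t /h; rewrite before_rev //; tauto.
Qed.
End Extrema.

(** * Effect of one step on the violations of the order *)

(* [lt] satisfies the conditions characterizing the order of the specialization,
   except that [pi] inverts the pairs (x, al) with x in [E], and the pairs of [Q]. *)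
Record sorted_except (T : finType) (lt : rel T) (delta : T -> bool)
    (pi : {perm T}) (al : T) (E : {set T}) (Q : rel T) : Prop := SortedExcept {
  se_order : strict_total lt;
  se_01 : forall x y, ~~ delta x -> delta y -> lt (pi x) (pi y);
  se_eq : forall x y, delta x = delta y -> lt x y ->
    lt (pi y) (pi x) = ((y == al) && (x \in E)) || Q x y;
  se_E : forall x, x \in E -> delta x = delta al /\ lt x al;
  se_Q : forall x y, Q x y -> delta x = delta y /\ lt x y }.

Section Step.
Variables (T : finType) (lt lt' : rel T) (delta : T -> bool) (pi : {perm T}).
Variables (al tm : T) (E : {set T}) (Q : rel T).
Hypothesis se : sorted_except lt delta pi al E Q.
Hypothesis tmE : tm \in E.
Hypothesis tm_max : forall t, t \in E -> t = tm \/ lt t tm.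
Hypothesis piE : forall t, t \in E -> pi t != al.
Hypothesis QE : forall x y, Q x y ->
  [/\ x \notin E, y \notin E, (forall t, t \in E -> x != pi t),
    (forall t, t \in E -> y != pi t) & y != al].
Hypothesis lt'_order : strict_total lt'.
(** For a general order [lt] this describes a move to the right of [pi tm]; for a reversed order it
    describes a move to the left. *)
Hypothesis lt'l : forall v, v != pi al -> lt' (pi al) v = lt (pi tm) v.
Hypothesis lt'E : forall u v, u != pi al -> v != pi al -> lt' u v = lt u v.

Let E' := [set pi t | t in E & delta (pi t) == delta (pi al)].

Let irr x : lt x x = false.
Proof. by case: (se_order se) => ->. Qed.

Let asym x y : lt x y -> lt y x = false.
Proof. exact: strict_total_asym (se_order se). Qed.

Let tr y x z : lt x y -> lt y z -> lt x z.
Proof. by case: (se_order se) => _ h _; apply: h. Qed.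

Let nlt x y : x <> y -> lt x y = false -> lt y x.
Proof. exact: strict_totalNlt (se_order se). Qed.

Let piEal t : t \in E -> lt (pi al) (pi t).
Proof.
move=> tE; have [dt ltt] := se_E se tE.
by rewrite (se_eq se dt ltt) eqxx tE.
Qed.

Let EnQ x y : x \in E -> (Q x y = false) * (Q y x = false).
Proof.
by move=> xE; split; apply/negP => /QE[]; rewrite xE.
Qed.

Let piEnQ x y : x \in E -> (Q (pi x) y = false) * (Q y (pi x) = false).
Proof.
move=> xE; split; apply/negP => /QE[_ _ h1 h2 _].
  by have := h1 _ xE; rewrite eqxx.
by have := h2 _ xE; rewrite eqxx.
Qed.

(* No element other than those of [pi @: E] is passed when [pi al] is moved: an
   element between [pi al] and [pi tm] is the image of a [t] with the digit of
   [al], by [se_01], and [t < tm], as otherwise (tm, t) would be inverted. *)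
Let lt_tm t : pi t != pi al -> lt (pi tm) (pi t) = lt (pi al) (pi t) && (t \notin E).
Proof.
rewrite inj_eq; last exact: perm_inj.
move=> tal; have [dtm ltm] := se_E se tmE.
apply/idP/andP => [h|[h tE]].
  split; first exact: tr (piEal tmE) h.
  apply/negP => tE; case: (tm_max tE) => [e|lt1]; first by rewrite e irr in h.
  have dt := (se_E se tE).1.
  have := se_eq se (etrans dt (esym dtm)) lt1.
  rewrite h (EnQ _ tE) orbF; move/esym/andP => [/eqP e _].
  by rewrite e irr in ltm.
apply: nlt; first by move/perm_inj => e; rewrite e tmE in tE.
apply/negP => h'.
case: (eqVneq (delta t) (delta al)) => [dt|dt]; last first.
  case dal : (delta al).
    have dt0 : ~~ delta t by rewrite dal in dt; case: (delta t) dt.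
    by have := se_01 se dt0 dal; rewrite asym.
  have dt1 : delta t by rewrite dal in dt; case: (delta t) dt.
  have dtm0 : ~~ delta tm by rewrite dtm dal.
  by have := se_01 se dtm0 dt1; rewrite asym.
case: (eqVneq t tm) => [e|ttm]; first by rewrite e tmE in tE.
have [_ _ tot] := se_order se.
case/orP: (tot t tm (fun e => negP ttm (introT eqP e))) => lt1.
  have := se_eq se dt (tr lt1 ltm); rewrite h eqxx (negbTE tE) /=.
  by move/esym/QE => [_ _ _ _]; rewrite eqxx.
have := se_eq se (etrans dtm (esym dt)) lt1.
by rewrite h' (EnQ _ tmE) orbF (negbTE tal).
Qed.

Let lt_tmV v : v != pi al ->
  lt (pi tm) v = lt (pi al) v && ((pi^-1)%g v \notin E).
Proof. by move=> vn; rewrite -{1 2}[v](permKV pi) lt_tm ?permKV. Qed.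

(** The pairs that the move reverses: [u] is before [v] in [lt] and after it in [lt']. *)
Let flip u v := (u == pi al) && [exists t in E, v == pi t].

Let flipP u v : reflect (u = pi al /\ exists2 t, t \in E & v = pi t) (flip u v).
Proof.
apply: (iffP andP) => [[/eqP-> /exists_inP[t tE /eqP->]]|[-> [t tE ->]]].
  by split=> //; exists t.
by rewrite eqxx; split=> //; apply/exists_inP; exists t.
Qed.

Let flip_nal u v : flip u v -> v != pi al.
Proof.
move/flipP => [_ [t tE ->]]; rewrite inj_eq; last exact: perm_inj.
by apply/eqP => e; have [_] := se_E se tE; rewrite e irr.
Qed.

Let lt'_flip u v : flip u v -> (lt' u v = false) * (lt' v u = true) * (lt u v = true).
Proof.
move=> f; have vn := flip_nal f; move/flipP: f vn => [-> [t tE ->]] vn.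
have e : lt' (pi al) (pi t) = false by rewrite lt'l // lt_tm // tE andbF.
split; [split=> //|exact: piEal].
apply: strict_totalNlt lt'_order _ e; by apply/eqP; rewrite eq_sym.
Qed.

Let lt'_noflip u v : ~~ flip u v -> ~~ flip v u -> lt' u v = lt u v.
Proof.
have inE_flip w : ~~ flip (pi al) w -> ((pi^-1)%g w \in E) = false.
  move=> f; apply/negP => wE; case/flipP: f; split=> //.
  by exists (pi^-1 w)%g; rewrite ?permKV.
case: (eqVneq u (pi al)) => [->|un]; case: (eqVneq v (pi al)) => [->|vn] fuv fvu.
- by rewrite irr; case: lt'_order => ->.
- by rewrite lt'l // lt_tmV // inE_flip // andbT.
- have uv : pi al <> u by apply/eqP; rewrite eq_sym.
  have e : lt' (pi al) u = lt (pi al) u.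
    by rewrite lt'l // lt_tmV // inE_flip // andbT.
  case l : (lt u (pi al)).
    by apply: strict_totalNlt lt'_order uv _; rewrite e asym.
  apply: (strict_total_asym lt'_order); rewrite e.
  by apply: nlt l => /esym.
- exact: lt'E.
Qed.

(** The move reverses exactly the pairs ([pi al], [pi t]) with [t] in [E]. This repairs the
    violations ([t], [al]). It creates the violations ([pi t], [pi al]) with equal digits, whose
    images still follow the old order. [QE] keeps the pairs of [Q] and their images away from the
    reversals. *)
Lemma sorted_except_step : sorted_except lt' delta pi (pi al) E' Q.
Proof.
split=> //.
- move=> x y dx dy; rewrite lt'_noflip; first exact: (se_01 se dx dy).
    apply/negP => /flipP[/perm_inj ex [t tE /perm_inj ey]].
    by have := (se_E se tE).1; rewrite -ex -ey (negbTE dx) dy.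
  apply/negP => /flipP[/perm_inj ex [t tE /perm_inj ey]].
  by have := (se_E se tE).1; rewrite -ex -ey (negbTE dx) dy.
- move=> x y dxy ltxy.
  have E'P : (y == pi al) && (x \in E') = flip y x.
    apply/andP/flipP => [[/eqP -> /imsetP[t]]|[ey [t tE ex]]].
      by rewrite inE => /andP[tE _] ->; split=> //; exists t.
    rewrite ey eqxx; split=> //; apply/imsetP; exists t => //.
    by rewrite inE tE -ex -ey dxy /=.
  rewrite E'P; case: (boolP (flip y x)) => fyx /=.
    have [_ ltyx] := lt'_flip fyx.
    case/flipP: fyx ltyx => ey [t tE ex] ltyx.
    have Qyx : Q y x = false by rewrite ex piEnQ.
    (* In the old order [y] precedes [x], without violation because [x = pi t] is not [al]. So
       [pi y] precedes [pi x], against the new order of [x] and [y]. *)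
    have := se_eq se (esym dxy) ltyx; rewrite Qyx orbF ex (negbTE (piE tE)) /=.
    rewrite -ex => xy.
    have ltyx' : lt (pi y) (pi x).
      by apply: nlt xy => /perm_inj e; rewrite e irr in ltyx.
    case: (boolP (flip (pi x) (pi y))) => [f|fxy']; first by rewrite (lt'_flip f).
    case: (boolP (flip (pi y) (pi x))) => [|fyx']; last by rewrite lt'_noflip.
    move/flipP => [/perm_inj ey' [t' t'E /perm_inj ex']].
    have [_] := se_E se t'E; rewrite -ex' -ey'.
    by rewrite asym.
  have fxy : ~~ flip x y by apply/negP => f; rewrite (lt'_flip f) in ltxy.
  rewrite lt'_noflip // in ltxy.
  case: (boolP (flip (pi y) (pi x))) => [f|fyx'].
    rewrite (lt'_flip f); move/flipP: f => [_ [t tE /perm_inj ->]].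
    by rewrite EnQ.
  case: (boolP (flip (pi x) (pi y))) => [|fxy'].
    move/flipP => [/perm_inj ex [t tE /perm_inj ey]].
    by have [_] := se_E se tE; rewrite -ex -ey asym.
  rewrite lt'_noflip // (se_eq se dxy ltxy).
  (* The old violations ([x], [al]) are gone: their images form a reversed pair. *)
  case: (boolP (_ && _)) => //= /andP[/eqP ey xE].
  case/flipP: fyx'; rewrite ey; split=> //; by exists x.
- move=> x /imsetP[t]; rewrite inE => /andP[tE /eqP dt] ->; split=> //.
  have f : flip (pi al) (pi t) by apply/flipP; split=> //; exists t.
  by rewrite (lt'_flip f).
- move=> x y q; have [dxy lxy] := se_Q se q; split=> //.
  have [_ _ hx hy _] := QE q.
  rewrite lt'_noflip //.
    by apply/negP => /flipP[_ [t tE /eqP e]]; have := hy _ tE; rewrite e.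
  by apply/negP => /flipP[_ [t tE /eqP e]]; have := hx _ tE; rewrite e.
Qed.
End Step.

(** * The sets A^(n) and B^(n) *)

Section AgreeingImages.
Variables (T : finType) (delta : T -> bool) (pi : {perm T}) (x0 : T) (X : {set T}).

(** Iterates the passage from [E] to the new exceptional set of [sorted_except_step], starting from
    [X]. *)
Fixpoint agreeing_images (n : nat) : {set T} :=
  if n is n'.+1 then
    [set pi t | t in agreeing_images n' & delta (pi t) == delta (iter n pi x0)]
  else X.

(** The place 0 is not compared: in both uses the elements of [X] have the digit of [x0]. *)
Lemma agreeing_imagesP n t : t \in agreeing_images n <-> exists2 z, z \in X &
  t = iter n pi z /\
  forall k, 0 < k <= n -> delta (iter k pi z) = delta (iter k pi x0).
Proof.
elim: n t => [|n IH] t /=.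
  split=> [tX|[z zX [-> _]] //]; exists t => //; split=> // k; lia.
split.
  move/imsetP => [u]; rewrite inE => /andP[/IH[z zX [-> h]] /eqP d] ->.
  exists z => //; split=> // k kn.
  case: (eqVneq k n.+1) => [-> //|kn']; apply: h; lia.
case=> z zX [-> h]; apply/imsetP; exists (iter n pi z) => //.
rewrite inE (h n.+1) ?eqxx ?andbT; last lia.
apply/IH; exists z => //; split=> // k kn; apply: h; lia.
Qed.
End AgreeingImages.

Lemma iter_perm_inj (T : finType) (pi : {perm T}) n : injective (iter n pi).
Proof. by elim: n => [|n IH] x y //= /perm_inj /IH. Qed.

(** * The two processes in terms of agreeing orbits *)

Section Process.
Variables (T1 T2 : finType).
Local Notation T := (T1 + T2)%type.
Variables (S : ABS T) (a b : T).
Local Notation delta := (abs_delta S).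
Local Notation pi0 := (abs_pi S).
Local Notation pi := (small_mod pi0 a b).
Local Notation lt := (abs_lt S).

Hypothesis pi_eq : forall x y, delta x = delta y -> lt (pi0 x) (pi0 y) = lt x y.
Hypothesis pi_01 : forall x y, ~~ delta x -> delta y -> lt (pi0 x) (pi0 y).
Hypotheses (da : ~~ delta a) (db : delta b) (ab : lt a b).

Definition zeros_between := [set z | [&& ~~ delta z, lt a z & lt z b]].
Definition ones_between := [set w | [&& delta w, lt a w & lt w b]].
Local Notation Z := zeros_between.
Local Notation W := ones_between.

Hypotheses (Zl : forall z, z \in Z -> is_inl z) (Wr : forall w, w \in W -> ~~ is_inl w).
Hypothesis pi0l : forall t, is_inl (pi0 t) = is_inl t.
Hypotheses (al : is_inl a) (br : ~~ is_inl b).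

Local Notation runA := (agreeing_images delta pi a Z).
Local Notation runB := (agreeing_images delta pi b W).

(** Stated with [runA], which makes sense for every [n]; it is shown to be the set A^(n) only while
    the process is defined and no earlier hit has occurred. *)
Definition hitA n := [exists t in runA n, pi t == b].
Definition hitB n := [exists t in runB n, pi t == a].

(** Ensures that the element moved in the A-process is never one of the ones in [W], so the pairs of
    [Q] survive. *)
Hypothesis alphal : forall n t, (forall k, k < n -> ~~ hitA k) ->
  t \in runA n -> is_inl (iter n pi a).

Let sT x : x \in abs_order S.
Proof. by rewrite (perm_mem (abs_orderP S)) mem_enum. Qed.

Let us : uniq (abs_order S).
Proof. by rewrite (perm_uniq (abs_orderP S)) enum_uniq. Qed.

Let lt_order : strict_total lt.
Proof. exact: strict_total_before. Qed.

Let asym x y : lt x y -> lt y x = false.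
Proof. exact: strict_total_asym. Qed.

Let irr x : lt x x = false.
Proof. by case: lt_order => ->. Qed.

Let aNb : a != b.
Proof. by apply/eqP => e; move: da; rewrite e db. Qed.

(** The exchange puts [b] before every [w] in [W]. The A-process leaves these violations alone; in
    the reversed order they start the B-process. *)
Let Q : rel T := fun x y => (x == b) && (y \in W).

Let s0 := [seq tperm a b t | t <- abs_order S].

Let before_s0 x y : before s0 x y = lt (tperm a b x) (tperm a b y).
Proof.
have h z : index z s0 = index (tperm a b z) (abs_order S).
  by rewrite -{1}[z](tpermK a b) index_map //; exact: perm_inj.
by rewrite /before !h.
Qed.

Let perm_s0 : perm_eq s0 (abs_order S).
Proof.
apply: uniq_perm => //; first by rewrite map_inj_uniq //; exact: perm_inj.
move=> x; rewrite sT; apply/mapP; exists (tperm a b x) => //; by rewrite tpermK.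
Qed.

Let before_perm (s : seq T) : perm_eq s (abs_order S) ->
  [/\ uniq s, (forall x, x \in s) & strict_total (before s)].
Proof.
move=> ps; have h x : x \in s by rewrite (perm_mem ps) sT.
split=> //; first by rewrite (perm_uniq ps).
exact: strict_total_before.
Qed.

(** Since [tperm a b (pi x) = pi0 x], the images under [pi] compare in [s0] as those under [pi0] do
    in [S]. Only comparisons of arguments involving [a] or [b] have changed. *)
Lemma sorted_except0 : sorted_except (before s0) delta pi a Z Q.
Proof.
have piE x : tperm a b (pi x) = pi0 x by rewrite permM tpermK.
split.
- by have [] := before_perm perm_s0.
- by move=> x y dx dy; rewrite before_s0 !piE pi_01.
- move=> x y dxy; rewrite !before_s0 !piE pi_eq // /Q !inE.
  case: tpermP => [->|ex|/eqP xa /eqP xb].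
  + rewrite (negbTE aNb) /= orbF => h.
    rewrite irr !andbF /=.
    case: tpermP h => [->|->|_ _]; first by rewrite irr.
    * by rewrite asym ?ab.
    * move=> h; apply: asym; case: lt_order => _ tr _; exact: tr ab h.
  + rewrite ex eqxx db /=; case: tpermP => [ey|->|]; rewrite ?irr //.
      by move: dxy; rewrite ex ey db (negbTE da).
    by move=> _ _ lay; rewrite lay -dxy ex db /= andbF.
  + rewrite (negbTE xb) /= orbF.
    case: tpermP => [ey|->|/eqP ya /eqP yb].
    * by move=> h; rewrite dxy ey eqxx da h andbT.
    * rewrite eq_sym (negbTE aNb) => h; apply: asym.
      case: lt_order => _ tr _; exact: tr h ab.
    * by rewrite (negbTE ya) => h; rewrite asym.
- move=> x; rewrite inE before_s0 => /and3P[dx ax xb].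
  split; first by rewrite (negbTE dx) (negbTE da).
  rewrite tpermL tpermD //; apply/eqP => e; move: ax xb; rewrite -e ?irr //.
- move=> x y /andP[/eqP-> ]; rewrite inE before_s0 => /and3P[dy ay yb].
  split; first by rewrite dy.
  rewrite tpermR tpermD //; apply/eqP => e; move: ay yb; rewrite -e ?irr //.
Qed.

Let alphaE n : alpha S a b n = iter n pi a.
Proof. exact: permX. Qed.

Let betaE n : beta S a b n = iter n pi b.
Proof. exact: permX. Qed.

Let pi_inl t : is_inl t -> pi t != b -> is_inl (pi t).
Proof.
move=> tl; rewrite permM; case: tpermP => [_|e|_ _]; rewrite ?eqxx //.
by rewrite pi0l.
Qed.

Lemma runA_inl n t : (forall k, k < n -> ~~ hitA k) -> t \in runA n -> is_inl t.
Proof.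
elim: n t => [|n IH] t nh /=; first exact: Zl.
move/imsetP => [u]; rewrite inE => /andP[uE _ ->].
apply: pi_inl; first by apply: IH uE => k kn; apply: nh; lia.
apply/eqP => e; case/existsP: (nh n (ltnSn n)); exists u; by rewrite uE e eqxx.
Qed.

(** The defining condition singles out the violations whose larger element is [alpha n]; those in
    [Q] drop out because [b] is not in A. *)
Lemma setA_inE s n : (forall k, k < n -> ~~ hitA k) ->
  sorted_except (before s) delta pi (iter n pi a) (runA n) Q ->
  setA_in S a b s n = runA n.
Proof.
move=> nh se; apply/setP => t; rewrite !inE !alphaE; apply/and4P/idP.
  case=> tl /eqP dt ltt ltp; have := se_eq se dt ltt.
  rewrite [before _ _ _]ltp eqxx /= /Q => /esym/orP[//|/andP[/eqP e _]].
  by rewrite e (negbTE br) in tl.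
move=> tE; have [dt ltt] := se_E se tE; split=> //; first exact: runA_inl tE.
  by rewrite dt.
by have := se_eq se dt ltt; rewrite eqxx tE.
Qed.

Lemma stageA_sorted n s : (forall k, k < n -> ~~ hitA k) ->
  stageA S a b n = Some s ->
  perm_eq s (abs_order S) /\
  sorted_except (before s) delta pi (iter n pi a) (runA n) Q.
Proof.
elim: n s => [|n IH] s nh /=.
  by case=> <-; split; [exact: perm_s0|exact: sorted_except0].
case e : (stageA S a b n) => [r|//].
have nh' k : k < n -> ~~ hitA k by move=> kn; apply: nh; lia.
have [pr se] := IH r nh' e.
have [ur rT _] := before_perm pr.
have := max_inP (setA_in S a b r n) ur rT.
case: (max_in _ _) => // tm; rewrite setA_inE // => -[tmE tm_max] [<-].
have pal : pi tm != iter n.+1 pi a.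
  rewrite /= inj_eq; last exact: perm_inj.
  apply/eqP => et; have [_] := se_E se tmE; rewrite et.
  by case: (se_order se) => ->.
have pm : perm_eq (move_right_of (alpha S a b n.+1) (pi tm) r) (abs_order S).
  by apply: perm_trans (perm_move_right_of _ _) pr.
split=> //; rewrite alphaE in pm *.
have inlpi t : t \in runA n -> is_inl (pi t).
  move=> tE; apply: pi_inl (runA_inl nh' tE) _.
  by apply/eqP => et; case/existsP: (nh n (ltnSn n)); exists t; rewrite tE et eqxx.
apply: (sorted_except_step se tmE tm_max).
- move=> t /agreeing_imagesP[z zZ [-> _]]; rewrite -iterS iterSr.
  apply/eqP => /iter_perm_inj => eza.
  have : pi0 z = b by apply: (@perm_inj _ (tperm a b)); rewrite tpermR -permM.
  by move=> ezb; have := Zl zZ; rewrite -pi0l ezb (negbTE br).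
- move=> x y /andP[/eqP-> yW]; have yr := Wr yW; split.
  + by apply/negP => /(runA_inl nh'); rewrite (negbTE br).
  + by apply/negP => /(runA_inl nh'); rewrite (negbTE yr).
  + by move=> t /inlpi tl; apply/eqP => eb; rewrite -eb (negbTE br) in tl.
  + by move=> t /inlpi tl; apply/eqP => eb; rewrite -eb (negbTE yr) in tl.
  + by apply/eqP => ey; rewrite ey (alphal nh' tmE) in yr.
- by have [] := before_perm pm.
- by move=> v vn; apply: before_move_right_ofl.
- by move=> u v un vn; rewrite before_move.
Qed.

Lemma stageA_defined n : (forall k, k < n -> ~~ hitA k) ->
  (forall k, k < n -> runA k != finset.set0) -> exists s, stageA S a b n = Some s.
Proof.
elim: n => [|n IH] nh ne /=; first by eexists.
have nh' k : k < n -> ~~ hitA k by move=> kn; apply: nh; lia.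
case: IH => // [k kn|s es]; first by apply: ne; lia.
rewrite es; have [ps se] := stageA_sorted nh' es.
have [ur rT _] := before_perm ps.
have := max_inP (setA_in S a b s n) ur rT.
case: (max_in _ _) => [tm _|]; first by eexists.
by rewrite setA_inE // => e; have := ne n (ltnSn n); rewrite e eqxx.
Qed.

Lemma first_hitA n : (exists k, k < n /\ hitA k) \/ (forall k, k < n -> ~~ hitA k).
Proof.
elim: n => [|n [[k [kn hk]]|IH]]; first by right.
  by left; exists k; split=> //; lia.
case: (boolP (hitA n)) => hn; first by left; exists n.
by right=> k; rewrite ltnS leq_eqVlt => /predU1P[->|/IH].
Qed.

Lemma in_calA_hit n : in_calA S a b n (pi^-1 b)%g -> exists k, hitA k.
Proof.
case=> X; rewrite /calA; case e : (stageA S a b n) => [s|//] [<-] tX.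
case: (first_hitA n) => [[k [_ hk]]|nh]; first by exists k.
have [_ se] := stageA_sorted nh e; rewrite setA_inE // in tX.
by exists n; apply/existsP; exists (pi^-1 b)%g; rewrite tX permKV eqxx.
Qed.

Lemma agreeing_images_nonempty (x0 : T) (X : {set T}) n k t :
  t \in agreeing_images delta pi x0 X n -> k <= n -> agreeing_images delta pi x0 X k != finset.set0.
Proof.
case/agreeing_imagesP => z zX [_ h] kn; apply/set0Pn; exists (iter k pi z).
by apply/agreeing_imagesP; exists z => //; split=> // l lk; apply: h; lia.
Qed.

(** Up to the first hit the stages are defined: the earlier runs contain images of the same [z] and
    so are nonempty. *)
Lemma hit_in_calA n : hitA n -> exists k, in_calA S a b k (pi^-1 b)%g.
Proof.
elim/ltn_ind: n => n IH hn.
case: (first_hitA n) => [[k [kn hk]]|nh]; first exact: IH hk.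
case/existsP: hn => t /andP[tn /eqP et].
have [|s es] := stageA_defined nh; first by move=> k kn; apply: agreeing_images_nonempty tn _; lia.
have et' : (pi^-1)%g b = t by apply: (@perm_inj _ pi); rewrite permKV.
exists n, (runA n); last by rewrite et'.
by rewrite /calA es /= setA_inE //; have [] := stageA_sorted nh es.
Qed.

Lemma calA_set0 c s : (forall k, ~~ hitA k) -> stageA S a b c = Some s ->
  (calA S a b c == Some finset.set0) = (runA c == finset.set0).
Proof.
move=> nh es; have [_ se] := stageA_sorted (fun k _ => nh k) es.
by rewrite /calA es /= setA_inE //; apply/eqP/eqP => [[]//|->].
Qed.

Lemma setB_inE s n :
  sorted_except (fun x y => before s y x) (fun x => ~~ delta x) pi (iter n pi b)
    (runB n) (fun _ _ => false) ->
  setB_in S a b s n = runB n.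
Proof.
move=> se; apply/setP => t; rewrite !inE !betaE; apply/and3P/idP.
  case=> /eqP dt ltt ltp; have := se_eq se (congr1 negb dt) ltt.
  by rewrite [before _ _ _]ltp eqxx orbF => /esym.
move=> tE; have [/negb_inj dt ltt] := se_E se tE; split=> //; first by rewrite dt.
by have := se_eq se (congr1 negb dt) ltt; rewrite eqxx tE.
Qed.

(* The B-process is the A-process for the reversed order and complemented digits. *)
Lemma stageB_sorted c n s : (forall k, ~~ hitA k) -> stageB S a b c n = Some s ->
  perm_eq s (abs_order S) /\
  sorted_except (fun x y => before s y x) (fun x => ~~ delta x) pi (iter n pi b)
    (runB n) (fun _ _ => false).
Proof.
move=> nh; elim: n s => [|n IH] s /=.
  case: eqP => // e es; have [ps se] := stageA_sorted (fun k _ => nh k) es.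
  (* Once A^(c) is empty, only the pairs of [Q] remain; reversed, they are the ([w], [b]) with [w]
     in [W]. *)
  move/eqP: e; rewrite (calA_set0 nh es) => /eqP e0; rewrite e0 in se.
  split=> //; split.
  - exact: strict_total_rev (se_order se).
  - by move=> x y /negPn dx dy; apply: (se_01 se).
  - move=> x y /negb_inj dxy lyx.
    by have := se_eq se (esym dxy) lyx; rewrite inE andbF orbF.
  - move=> x xW; have [|dx lx] := se_Q se (x := b) (y := x).
      by rewrite /Q eqxx.
    by rewrite dx.
  - by [].
case e : (stageB S a b c n) => [r|//].
have [pr se] := IH r e.
have [ur rT _] := before_perm pr.
have := min_inP (setB_in S a b r n) ur rT.
case: (min_in _ _) => // tm; rewrite setB_inE // => -[tmE tm_min] [<-].
have pal : pi tm != iter n.+1 pi b.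
  rewrite /= inj_eq; last exact: perm_inj.
  apply/eqP => et; have [_] := se_E se tmE; rewrite et.
  by case: (se_order se) => ->.
have pm : perm_eq (move_left_of (beta S a b n.+1) (pi tm) r) (abs_order S).
  by apply: perm_trans (perm_move_left_of _ _) pr.
split=> //; rewrite betaE in pm *.
have tr' := strict_total_rev.
rewrite [X in sorted_except _ _ _ _ X](_ : _ = [set pi t | t in runB n &
    ~~ delta (pi t) == ~~ delta (pi (iter n pi b))]); last first.
  by apply/setP => u; apply/imsetP/imsetP => -[t tE ->]; exists t => //;
     move: tE; rewrite !inE (inj_eq negb_inj).
apply: (sorted_except_step se tmE tm_min) => //.
- move=> t /agreeing_imagesP[w wW [-> _]]; rewrite -iterS iterSr.
  apply/eqP => /iter_perm_inj ewb.
  have : pi0 w = a by apply: (@perm_inj _ (tperm a b)); rewrite tpermL -permM.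
  by move=> ewa; have := Wr wW; rewrite -pi0l ewa al.
- by have [_ _ /tr'] := before_perm pm.
- by move=> v vn; apply: before_move_left_ofr.
- by move=> u v un vn; rewrite before_move.
Qed.

Lemma in_calB_hit n : (forall k, ~~ hitA k) ->
  in_calB S a b n (pi^-1 a)%g -> hitB n.
Proof.
move=> nh [c [X]]; rewrite /calB; case e : (stageB S a b c n) => [s|//] [<-] tX.
have [_ se] := stageB_sorted nh e; rewrite setB_inE // in tX.
by apply/existsP; exists (pi^-1 a)%g; rewrite tX permKV eqxx.
Qed.

Lemma stageA_stops : (forall k, ~~ hitA k) -> (exists c, runA c = finset.set0) ->
  exists c s, stageA S a b c = Some s /\ runA c = finset.set0.
Proof.
move=> nh exc; have exc' : exists c, runA c == finset.set0.
  by case: exc => c ec; exists c; apply/eqP.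
case: (ex_minnP exc') => c /eqP c0 cmin; exists c.
have [k kc|s es] := stageA_defined (n := c) (fun k _ => nh k).
  by apply/negP => /cmin; lia.
by exists s.
Qed.

(** The B-process starts only where the A-process stops, hence the second premise. No first hit is
    needed here: [setB_in] is not restricted to one component, so [stageB_sorted] persists after a
    hit. *)
Lemma hit_in_calB n : (forall k, ~~ hitA k) -> (exists c, runA c = finset.set0) ->
  hitB n -> in_calB S a b n (pi^-1 a)%g.
Proof.
move=> nh exc /existsP[t /andP[tn /eqP et]].
have [c [s [es c0]]] := stageA_stops nh exc; exists c.
have [r er] : exists r, stageB S a b c n = Some r.
  have : forall k, k <= n -> exists r, stageB S a b c k = Some r; last exact.
  elim=> [|k IH] kn /=; first by rewrite (calA_set0 nh es) c0 eqxx; exists s.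
  have [|r er] := IH; first lia.
  rewrite er; have [pr se] := stageB_sorted nh er.
  have [ur rT _] := before_perm pr.
  have := min_inP (setB_in S a b r k) ur rT.
  case: (min_in _ _) => [tm _|]; first by eexists.
  rewrite setB_inE // => e0.
  by have := agreeing_images_nonempty tn (ltnW kn); rewrite e0 eqxx.
have et' : (pi^-1)%g a = t by apply: (@perm_inj _ pi); rewrite permKV.
exists (runB n); last by rewrite et'.
by rewrite /calB er /= setB_inE //; have [] := stageB_sorted nh er.
Qed.

(** If the A-process hits, both sides hold at once; otherwise it stops and the B-process can be
    compared with [runB]. *)
Lemma in_cal_hit : ((forall k, ~~ hitA k) -> exists c, runA c = finset.set0) ->
  (exists n, in_calA S a b n (pi^-1 b)%g \/ in_calB S a b n (pi^-1 a)%g) <->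
  (exists n, hitA n || hitB n).
Proof.
move=> stop; case: (pselect (exists k, hitA k)) => [[k hk]|nex].
  split=> _; first by exists k; rewrite hk.
  by have [n ?] := hit_in_calA hk; exists n; left.
have nh k : ~~ hitA k by apply/negP => hk; apply: nex; exists k.
split=> -[n].
  case=> [/in_calA_hit//|/(in_calB_hit nh) hn]; by exists n; rewrite hn orbT.
case/orP => [hn|hn]; first by have := nh n; rewrite hn.
by exists n; right; apply: hit_in_calB (stop nh) hn.
Qed.
End Process.

(** * Change of the length *)

(** Here [w] is [W01], [c] the number of pairs in [E], and [x], [y] count those in increasing order
    for [lt'] and [lt]. The premise eliminates [w]. *)
Local Lemma length_arith (w c x y : int) :
  (0 = (w - (x *+ 2 - c)) *+ 2 -> (w - (y *+ 2 - c)) *+ 2 = (x - y) *+ 4)%R.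
Proof. lia. Qed.

Local Lemma length_arith2 (s x y : int) :
  (- (1 + s) *+ 4 = (x - y) *+ 4 -> x = y - 1 <-> s = 0)%R.
Proof. lia. Qed.

Section WordOrder.
Variables (T : finType) (delta : T -> bool) (pi : {perm T}).

Definition word_lt (x y : T) : Prop := exists k,
  [/\ forall l, l < k -> delta (iter l pi x) = delta (iter l pi y),
      ~~ delta (iter k pi x) & delta (iter k pi y)].

Lemma word_lt_asym x y : word_lt x y -> ~ word_lt y x.
Proof.
move=> [k [kE kx ky]] [l [lE ly lx]].
case: (ltngtP k l) => kl.
- by move: (lE _ kl) kx; rewrite ky => <-.
- by move: (kE _ kl) ly; rewrite lx => <-.
- by move: ly; rewrite -kl ky.
Qed.

Lemma word_lt01 x y : ~~ delta x -> delta y -> word_lt x y.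
Proof. by exists 0. Qed.

Lemma word_lt_iter n x y :
  (forall l, l < n -> delta (iter l pi x) = delta (iter l pi y)) ->
  word_lt x y <-> word_lt (iter n pi x) (iter n pi y).
Proof.
move=> agr; split=> -[k [kE kx ky]].
  have nk : n <= k.
    by rewrite leqNgt; apply/negP => kn; move: kx; rewrite (agr _ kn) ky.
  exists (k - n); rewrite -!iterD subnK //; split=> // l lk.
  by rewrite -!iterD; apply: kE; lia.
exists (k + n); rewrite !iterD; split=> // l lk.
case: (ltnP l n) => ln; first exact: agr.
by rewrite -(subnK ln) !iterD; apply: kE; lia.
Qed.

Lemma word_lt_step x y : delta x = delta y ->
  word_lt x y <-> word_lt (pi x) (pi y).
Proof. by move=> dxy; apply: (@word_lt_iter 1) => -[]. Qed.

Local Open Scope ring_scope.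

(** The function G of the reindexing argument; equal words give 0. *)
Definition word_sg (x y : T) : int := (`[< word_lt x y >])%:Z - (`[< word_lt y x >])%:Z.

Lemma word_sgC x y : word_sg y x = - word_sg x y.
Proof. by rewrite /word_sg opprB. Qed.

Lemma word_sg01 x y : ~~ delta x -> delta y -> word_sg x y = 1.
Proof.
move=> dx dy; have l := word_lt01 dx dy.
by rewrite /word_sg (asboolT l) asboolF //; exact: word_lt_asym.
Qed.

Lemma word_sg_step x y : delta x = delta y -> word_sg (pi x) (pi y) = word_sg x y.
Proof.
move=> dxy; congr ((nat_of_bool _)%:Z - (nat_of_bool _)%:Z); apply: asbool_equiv_eq.
  by have [h1 h2] := word_lt_step dxy.
by have [h1 h2] := word_lt_step (esym dxy).
Qed.

Lemma word_sg_le1 x y : word_sg x y <= 1.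
Proof. by rewrite /word_sg; do 2 case: asboolP. Qed.

Lemma word_sg_eq1 x y : word_sg x y = 1 <-> word_lt x y.
Proof.
rewrite /word_sg; case: asboolP => [l|nl]; last by case: asboolP.
by rewrite asboolF //; exact: word_lt_asym.
Qed.

Definition order_sg (lt : rel T) (x y : T) : int := (lt x y)%:Z - (lt y x)%:Z.

Let E : pred (T * T) := fun p => ~~ delta p.1 && delta p.2.
Let eqd : pred (T * T) := fun p => delta p.1 == delta p.2.

(** The pairs with unequal digits are those of [E] and their mirror images. *)
Let sum_neq (F : T * T -> int) : (forall p, F (p.2, p.1) = F p) ->
  \sum_(p | ~~ eqd p) F p = (\sum_(p | E p) F p) *+ 2.
Proof.
move=> FC; rewrite (bigID E) /= mulr2n; congr (_ + _).
  apply: eq_bigl => -[x y]; rewrite /E /eqd /=.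
  by case: (delta x); case: (delta y).
rewrite (reindex_inj (h := fun p : T * T => (p.2, p.1))) /=; last first.
  by move=> [x y] [x' y'] [-> ->].
apply: eq_big => [[x y]|p _]; last exact: FC.
by rewrite /E /eqd /=; case: (delta x); case: (delta y).
Qed.

Let sum_reindex (F : T * T -> int) :
  \sum_p F p = \sum_p F (pi p.1, pi p.2).
Proof.
rewrite (reindex_inj (h := fun p : T * T => (pi p.1, pi p.2))) //.
by move=> [x y] [x' y'] /= [/perm_inj -> /perm_inj ->].
Qed.

(** The part of the reindexed sum that does not depend on the orders. *)
Let W01 := \sum_(p | E p) word_sg (pi p.1) (pi p.2).

Let order_sgC lt x y : order_sg lt y x = - order_sg lt x y.
Proof. by rewrite /order_sg opprB. Qed.

(* The sum of [sg' * word_sg] is reindexed by [pi]; for pairs with equal digits the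
   new term is that of [sg * word_sg], for the other pairs both are explicit. *)
Let sum_shift (sg sg' : T -> T -> int) :
  (forall x y, sg y x = - sg x y) -> (forall x y, sg' y x = - sg' x y) ->
  (forall x y, delta x = delta y -> sg' (pi x) (pi y) = sg x y) ->
  (forall x y, ~~ delta x -> delta y -> sg' (pi x) (pi y) = 1) ->
  \sum_p (sg' p.1 p.2 - sg p.1 p.2) * word_sg p.1 p.2
   = (W01 - \sum_(p | E p) sg p.1 p.2) *+ 2.
Proof.
move=> sgC sg'C sgE sg01.
under eq_bigr do rewrite mulrBl.
rewrite sumrB [X in X - _]sum_reindex /=.
rewrite (bigID eqd) [X in _ - X](bigID eqd) /=.
rewrite (eq_bigr (fun p => sg p.1 p.2 * word_sg p.1 p.2)); last first.
  by move=> p /eqP dp; rewrite sgE // word_sg_step.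
rewrite opprD addrACA subrr add0r.
rewrite !sum_neq /=; last 2 first.
- by move=> p; rewrite sgC word_sgC mulrNN.
- by move=> p; rewrite sg'C word_sgC mulrNN.
rewrite -mulrnBl; congr ((_ - _) *+ 2).
  by apply: eq_bigr => p /andP[dx dy]; rewrite sg01 // mul1r.
by apply: eq_bigr => p /andP[dx dy]; rewrite word_sg01 // mulr1.
Qed.

Let sum_order_sg (lt : rel T) : strict_total lt ->
  \sum_(p | E p) order_sg lt p.1 p.2
   = (\sum_(p | E p) (lt p.1 p.2)%:Z) *+ 2 - \sum_(p | E p) 1.
Proof.
move=> so; rewrite -sumrMnl -sumrB; apply: eq_bigr => -[x y] /andP[/= dx dy].
have xy : x <> y by move=> e; rewrite e dy in dx.
rewrite /order_sg; case l : (lt x y); first by rewrite (strict_total_asym so l).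
by rewrite (strict_totalNlt so xy l).
Qed.

(** [sum_shift] is applied to the sign of [lt] and [sg0], and again with the sign of [lt'] in both
    places, where the left side vanishes. Comparing the two eliminates [W01]. *)
Lemma order_length_diff (lt lt' : rel T) (sg0 : T -> T -> int) :
  strict_total lt -> strict_total lt' ->
  (forall x y, delta x = delta y -> lt' (pi x) (pi y) = lt' x y) ->
  (forall x y, ~~ delta x -> delta y -> lt' (pi x) (pi y)) ->
  (forall x y, sg0 y x = - sg0 x y) ->
  (forall x y, delta x = delta y -> sg0 (pi x) (pi y) = order_sg lt x y) ->
  (forall x y, ~~ delta x -> delta y -> sg0 (pi x) (pi y) = 1) ->
  \sum_x \sum_y (sg0 x y - order_sg lt x y) * word_sg x y
   = (\sum_(p | E p) (lt' p.1 p.2)%:Z - \sum_(p | E p) (lt p.1 p.2)%:Z) *+ 4.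
Proof.
move=> so so' lt'E lt'01 sg0C sg0E sg001.
rewrite pair_big /= (sum_shift (order_sgC lt) sg0C sg0E sg001).
have : \sum_p (order_sg lt' p.1 p.2 - order_sg lt' p.1 p.2) * word_sg p.1 p.2
   = (W01 - \sum_(p | E p) order_sg lt' p.1 p.2) *+ 2.
  apply: sum_shift => //.
  - by move=> x y dxy; rewrite /order_sg !lt'E.
  - by move=> x y dx dy; have l := lt'01 x y dx dy;
       rewrite /order_sg l (strict_total_asym so' l).
rewrite big1 => [|p _]; last by rewrite subrr mul0r.
rewrite !sum_order_sg //; exact: length_arith.
Qed.
End WordOrder.

(** * The length after exchanging a and b *)

Section LengthChange.
Variables (T : finType) (delta : T -> bool) (pi0 : {perm T}) (a b : T).
Variables (lt lt' : rel T).
Local Notation pi := (small_mod pi0 a b).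
Local Notation wsg := (word_sg delta pi).
Local Notation wlt := (word_lt delta pi).

Hypotheses (so : strict_total lt) (so' : strict_total lt').
Hypothesis pi_eq : forall x y, delta x = delta y -> lt (pi0 x) (pi0 y) = lt x y.
Hypothesis pi_01 : forall x y, ~~ delta x -> delta y -> lt (pi0 x) (pi0 y).
Hypothesis lt'_eq : forall x y, delta x = delta y -> lt' (pi x) (pi y) = lt' x y.
Hypothesis lt'_01 : forall x y, ~~ delta x -> delta y -> lt' (pi x) (pi y).
Hypotheses (da : ~~ delta a) (db : delta b) (ab : lt a b).

Local Open Scope ring_scope.

Let btw t := lt a t && lt t b.

Let asym x y : lt x y -> lt y x = false.
Proof. exact: strict_total_asym. Qed.

Let irr x : lt x x = false.
Proof. by case: so => ->. Qed.

Let tr y x z : lt x y -> lt y z -> lt x z.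
Proof. by case: so => _ h _; apply: h. Qed.

Let tot x y : x <> y -> lt x y || lt y x.
Proof. by case: so => _ _; apply. Qed.

(** Indicator of the pairs reversed by the exchange, written in their original order. *)
Let ind x y : int := ((x == a) && (y == b))%:Z + ((x == a) && btw y)%:Z
  + (btw x && (y == b))%:Z.

Let tperm_sg x y :
  order_sg lt (tperm a b x) (tperm a b y) - order_sg lt x y
  = (ind y x - ind x y) *+ 2.
Proof.
have aNb : (a == b) = false by apply/eqP => e; have := ab; rewrite e irr.
have bNa : (b == a) = false by rewrite eq_sym.
have ba := asym ab.
have btwP t : t <> a -> t <> b ->
  order_sg lt b t - order_sg lt a t = - (btw t)%:Z *+ 2.
  move=> ta tb; rewrite /order_sg /btw.
  have := tot ta; have := tot tb.
  case at_ : (lt a t) => [] /=; last first.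
    rewrite orbF => _ ta_; have tb_ := tr ta_ ab; by rewrite ta_ tb_ (asym tb_).
  case tb_ : (lt t b) => [] /=; first by rewrite (asym tb_) (asym at_).
  by move=> -> _; rewrite (asym at_).
have btwP' t : t <> a -> t <> b ->
  order_sg lt a t - order_sg lt b t = (btw t)%:Z *+ 2.
  by move=> ta tb; rewrite -opprB btwP // mulNrn opprK.
have sgC x' y' : order_sg lt y' x' = - order_sg lt x' y' by rewrite /order_sg opprB.
have neq (u v : T) : u <> v -> (u == v) = false by move=> h; apply/eqP.
rewrite /ind; case: tpermP => [->|->|xa xb]; case: tpermP => [->|->|ya yb];
  rewrite /btw ?eqxx ?irr ?aNb ?bNa ?ab ?ba ?andbF ?(neq _ _ xa) ?(neq _ _ xb)
    ?(neq _ _ ya) ?(neq _ _ yb) ?andbF ?andbT //=; rewrite -/(btw _).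
- by rewrite /order_sg !irr.
- by rewrite /order_sg ab ba.
- by rewrite btwP //; case: (btw y).
- by rewrite /order_sg ab ba.
- by rewrite /order_sg !irr.
- by rewrite btwP' //; case: (btw y).
- by rewrite !(sgC _ x) opprK addrC btwP' //; case: (btw x).
- by rewrite !(sgC _ x) opprK addrC btwP //; case: (btw x).
- by rewrite subrr.
Qed.

(** The summand 1 is [wsg a b]. *)
Let sum_ind : \sum_x \sum_y ind x y * wsg x y
  = 1 + \sum_(t | btw t) (wsg a t + wsg t b).
Proof.
have sum1 (F : T -> int) c : \sum_x (x == c)%:Z * F x = F c.
  rewrite (bigD1 c) //= eqxx mul1r big1 ?addr0 // => x /negbTE ->.
  by rewrite mul0r.
have sumb (F : T -> int) (P : pred T) : \sum_x (P x)%:Z * F x = \sum_(x | P x) F x.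
  rewrite [RHS]big_mkcond; apply: eq_bigr => x _.
  by case: (P x); rewrite ?mul1r ?mul0r.
have PoszM (u v : bool) : (u && v)%:Z = u%:Z * v%:Z by case: u; case: v.
rewrite (eq_bigr (fun x => (x == a)%:Z * (wsg x b + \sum_(t | btw t) wsg x t)
    + (btw x)%:Z * wsg x b)).
  by rewrite big_split /= sum1 sumb word_sg01 // -addrA -big_split.
move=> x _; rewrite -(sumb (wsg x)) -(sum1 (wsg x) b) mulrDr !mulr_sumr.
rewrite -!big_split /=; apply: eq_bigr => y _.
by rewrite /ind !PoszM !mulrDl !mulrA.
Qed.

Lemma exchange_length :
  (\sum_(p | ~~ delta p.1 && delta p.2) (lt' p.1 p.2)%:Z
     = \sum_(p | ~~ delta p.1 && delta p.2) (lt p.1 p.2)%:Z - 1 :> int)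
  <-> forall t, lt a t -> lt t b -> if delta t then wlt b t else wlt t a.
Proof.
have sg0C x y : order_sg lt (tperm a b y) (tperm a b x)
    = - order_sg lt (tperm a b x) (tperm a b y).
  by rewrite /order_sg opprB.
have piE x : tperm a b (pi x) = pi0 x by rewrite permM tpermK.
have := order_length_diff so so' lt'_eq lt'_01 sg0C.
have h1 x y : delta x = delta y ->
    order_sg lt (tperm a b (pi x)) (tperm a b (pi y)) = order_sg lt x y.
  by move=> dxy; rewrite !piE /order_sg !pi_eq.
have h2 x y : ~~ delta x -> delta y ->
    order_sg lt (tperm a b (pi x)) (tperm a b (pi y)) = 1.
  by move=> dx dy; have l := pi_01 dx dy; rewrite !piE /order_sg l asym.
move=> /(_ h1 h2).
under eq_bigr => x _ do under eq_bigr => y _ do rewrite tperm_sg.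
(* Both factors are antisymmetric, so the two halves agree; with the factor 2 from [tperm_sg] this
   makes 4. *)
have -> : \sum_x \sum_y (ind y x - ind x y) *+ 2 * wsg x y
    = - (1 + \sum_(t | btw t) (wsg a t + wsg t b)) *+ 4.
  rewrite -sum_ind.
  have -> : \sum_x \sum_y (ind y x - ind x y) *+ 2 * wsg x y
     = (\sum_x \sum_y ind y x * wsg x y - \sum_x \sum_y ind x y * wsg x y) *+ 2.
    rewrite -sumrB -sumrMnl; apply: eq_bigr => x _.
    rewrite -sumrB -sumrMnl; apply: eq_bigr => y _.
    by rewrite mulrnAl mulrBl.
  have -> : \sum_x \sum_y ind y x * wsg x y = - \sum_x \sum_y ind x y * wsg x y.
    rewrite exchange_big -sumrN; apply: eq_bigr => x _.
    by rewrite -sumrN; apply: eq_bigr => y _; rewrite word_sgC mulrN.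
  by rewrite -opprD -mulr2n -mulNrn -mulrnA.
(* The first digits make one summand equal to 1, and the other is at least -1. *)
have term_ge0 t : btw t -> 0 <= wsg a t + wsg t b.
  move=> _; case: (boolP (delta t)) => dt.
    by rewrite word_sg01 // -[wsg t b]opprK -word_sgC subr_ge0 word_sg_le1.
  by rewrite [wsg t b]word_sg01 // -[wsg a t]opprK -word_sgC addrC subr_ge0 word_sg_le1.
have term0 t : wsg a t + wsg t b = 0 <-> if delta t then wlt b t else wlt t a.
  case: (boolP (delta t)) => dt.
    rewrite word_sg01 // -[wsg t b]opprK -word_sgC -word_sg_eq1; lia.
  rewrite [wsg t b]word_sg01 // -[wsg a t]opprK -word_sgC -word_sg_eq1; lia.
set s := \sum_(t | btw t) _ => e.
have -> : (\sum_(p | ~~ delta p.1 && delta p.2) (lt' p.1 p.2)%:Z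
    = \sum_(p | ~~ delta p.1 && delta p.2) (lt p.1 p.2)%:Z - 1 :> int) <-> s = 0.
  exact: length_arith2.
split=> [s0 t at_ tb|h].
  by apply/term0; apply: (psumr_eq0P term_ge0 s0); rewrite /btw at_.
by apply: big1 => t /andP[at_ tb]; apply/term0; exact: h.
Qed.
End LengthChange.

(** * Order of the specialization *)

Lemma abs_lengthE (T : finType) (S : ABS T) :
  ((abs_length S)%:Z = \sum_(p | ~~ abs_delta S p.1 && abs_delta S p.2)
    (abs_lt S p.1 p.2)%:Z)%R.
Proof.
rewrite /abs_length -sum1_card -natz natr_sum big_mkcond [RHS]big_mkcond /=.
apply: eq_bigr => p _; rewrite inE.
by case: (abs_lt _ _ _); case: (abs_delta _ _); case: (abs_delta _ _).
Qed.

(** * Binary values compared with one half *)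

Section BinaryValue.
Local Open Scope ring_scope.
Import numFieldNormedType.Exports.
Variables (R : realType) (d : nat -> bool).

Let u (N : nat) : R := \sum_(1 <= x < N) (d x)%:R / 2 ^+ x.
(** The partial sum through place [N] plus the largest possible tail; [v] decreases and bounds the
    value from above. *)
Let v (N : nat) : R := u N.+1 + (2 ^+ N)^-1.

Let uS N : (0 < N)%N -> u N.+1 = u N + (d N)%:R / 2 ^+ N.
Proof. by move=> N0; rewrite /u big_nat_recr. Qed.

Let term_ge0 x : 0 <= (d x)%:R / 2 ^+ x :> R.
Proof. by rewrite divr_ge0 // exprn_ge0. Qed.

Let u_nd : nondecreasing_seq u.
Proof.
apply/nondecreasing_seqP => -[|N]; first by rewrite /u !big_geq.
by rewrite [u N.+2]uS // lerDl.
Qed.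

Let vS N : v N.+1 <= v N - (~~ d N.+1)%:R / 2 ^+ N.+1.
Proof.
rewrite /v [u N.+2]uS // exprS invfM.
have h : 0 < (2 ^+ N)^-1 :> R by rewrite invr_gt0 exprn_gt0.
case: (d N.+1) => /=; lra.
Qed.

Let v_ni : nonincreasing_seq v.
Proof.
apply/nonincreasing_seqP => N; apply: le_trans (vS N) _.
by rewrite gerBl divr_ge0 // exprn_ge0.
Qed.

Let u_le_v N : u N <= v N.
Proof.
apply: (@le_trans _ _ (u N.+1)); first exact: u_nd.
by rewrite lerDl invr_ge0 exprn_ge0.
Qed.

Let u_cvg : cvgn u.
Proof.
apply: nondecreasing_is_cvgn => //; exists (v 0) => _ [N _ <-].
by apply: le_trans (u_le_v N) _; exact: v_ni.
Qed.

Lemma binary_value_ge : d 1 -> 2^-1 <= limn u.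
Proof.
move=> d1; apply: limr_ge => //; exists 2%N => // N /= N2.
apply: le_trans (u_nd N2); rewrite /u big_nat1 d1 expr1 /=; lra.
Qed.

(** The first digit 0 alone gives at most 1/2, attained by 0.0111...; the second 0, at place [k],
    leaves a gap of 2^-k. *)
Lemma binary_value_lt k : (1 < k)%N -> ~~ d 1 -> ~~ d k -> limn u < 2^-1.
Proof.
case: k => // k k1 d1 dk.
have v1 : v 1 <= 2^-1 by apply: le_trans (vS 0) _; rewrite d1 /v /u big_geq // expr0 expr1 /=; lra.
have vk : v k.+1 <= 2^-1 - (2 ^+ k.+1)^-1.
  apply: le_trans (vS k) _; rewrite dk mul1r lerB //.
  by apply: le_trans v1; apply: v_ni.
apply: (@le_lt_trans _ _ (2^-1 - (2 ^+ k.+1)^-1)).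
  apply: limr_le => //; exists k.+1 => // N /= kN.
  by apply: le_trans (u_le_v N) (le_trans _ vk); exact: v_ni.
by rewrite ltrBlDr ltrDl invr_gt0 exprn_gt0.
Qed.
End BinaryValue.

Lemma specialization_order (R : realType) (T : finType) (S S' : ABS T) (pi : {perm T}) :
  is_specialization R S pi S' ->
  [/\ strict_total (abs_lt S'),
   forall x y, abs_delta S x = abs_delta S y ->
     abs_lt S' (pi x) (pi y) = abs_lt S' x y
   & forall x y, ~~ abs_delta S x -> abs_delta S y -> abs_lt S' (pi x) (pi y)].
Proof.
case=> dS' pS' h1 h2.
have so : strict_total (abs_lt S').
  by apply: strict_total_before => x; rewrite (perm_mem (abs_orderP S')) mem_enum.
split=> //; first by move=> x y /h2.
move=> x y dx dy; apply: (strict_totalNlt so) => [/perm_inj e|].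
  by move: dx; rewrite -e dy.
apply/negP => /h1; rewrite leNgt => /negP; apply.
have pi1 z : (pi ^- 1)%g (pi z) = z by rewrite expg1 permK.
(* The expansions of [pi x] and [pi y] start with [delta x = 0] and [delta y = 1], so 1/2 separates
   them. As [pi] has finite order, the 0 recurs at place [#[pi].+1], which gives strictness. *)
apply: (@lt_le_trans _ _ 2^-1%R).
  apply: (@binary_value_lt R (fun k => abs_delta S ((pi ^- k)%g (pi x))) #[pi]%g.+1).
  - by rewrite ltnS order_gt0.
  - by rewrite pi1.
  - by rewrite expgS expg_order mulg1 pi1.
by apply: (@binary_value_ge R (fun k => abs_delta S ((pi ^- k)%g (pi y)))); rewrite pi1.
Qed.

(** * Rotations *)

(** Subtraction of [m] modulo [m + n] on positions counted from 0. *)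
Definition rot_pos (m n k : nat) : nat := if k < m then k + n else k - m.

Lemma rot_pos_mod m n k : k < m + n -> (k + n) %% (m + n) = rot_pos m n k.
Proof.
move=> kh; rewrite /rot_pos; case: ifP => km; first by rewrite modn_small //; lia.
by rewrite (_ : k + n = k - m + (m + n)) ?modnDr ?modn_small //; lia.
Qed.

Lemma iter_rot_pos m n r k : k < m + n ->
  iter r (rot_pos m n) k = (k + r * n) %% (m + n).
Proof.
move=> kh; elim: r => [|r IH]; first by rewrite addn0 modn_small.
have h0 : 0 < m + n by lia.
by rewrite iterS IH -rot_pos_mod ?ltn_mod // modnDml mulSn addnCA addnC addnA.
Qed.

Lemma rot_pos_transitive m n p q : coprime m n -> p < m + n -> q < m + n ->
  exists r, iter r (rot_pos m n) q = p.
Proof.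
move=> cop ph qh.
have cop' : coprime n (m + n) by rewrite /coprime gcdnDr -/(coprime n m) coprime_sym.
(* A multiple of [n] congruent to [p - q] modulo [m + n]; the added [m + n] avoids truncated
   subtraction. *)
pose x := chinese n (m + n) 0 (p + (m + n) - q).
have /dvdnP[r er] : n %| x by rewrite /dvdn chinese_modl // mod0n.
exists r; rewrite iter_rot_pos // -er -modnDmr chinese_modr // modnDmr.
by rewrite (_ : q + _ = p + (m + n)) ?modnDr ?modn_small //; lia.
Qed.

(* As long as the digits agree, both orbits are translated by the same amounts, so
   that p can only return to p when q returns to q. *)
Lemma rot_pos_first_difference m n p q : coprime m n -> p < m + n -> q < m + n ->
  p != q -> exists N,
  [/\ forall k, k < N -> (iter k (rot_pos m n) q < m) = (iter k (rot_pos m n) p < m),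
      forall k, 0 < k <= N ->
        iter k (rot_pos m n) q != p /\ iter k (rot_pos m n) p != p,
      iter N (rot_pos m n) p + q = iter N (rot_pos m n) q + p
    & (iter N (rot_pos m n) q < m) <> (iter N (rot_pos m n) p < m) \/
      [/\ (iter N (rot_pos m n) q < m) = (iter N (rot_pos m n) p < m),
          iter N.+1 (rot_pos m n) q = p,
          iter N.+1 (rot_pos m n) p != p
        & iter N.+1 (rot_pos m n) p + q = p + p]].
Proof.
set g := rot_pos m n => cop ph qh pq.
have exr : exists r, iter r g q == p.
  by have [r e] := rot_pos_transitive cop ph qh; exists r; apply/eqP.
case: (ex_minnP exr) => r /eqP er rmin.
have r0 : 0 < r by case: r er {rmin} => // e; rewrite -e eqxx in pq.
have gS x y : (y < m) = (x < m) -> x + q = y + p -> g x + q = g y + p.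
  by rewrite /g /rot_pos; do 2 case: ifP; lia.
have gE k : (forall l, l < k -> (iter l g q < m) = (iter l g p < m)) ->
    iter k g p + q = iter k g q + p.
  elim: k => [|k IH] agr; first exact: addnC.
  have {}IH := IH (fun l lk => agr l (ltnW lk)).
  exact: gS (agr k (ltnSn k)) IH.
have noret k : 0 < k <= r -> (forall l, l < k -> (iter l g q < m) = (iter l g p < m)) ->
    iter k g p != p.
  move=> kr agr; apply/eqP => e.
  have eq : iter k g q = q by have := gE k agr; rewrite e; lia.
  (* If [p] returned after [k] steps, so would [q], which would then reach [p] in only [r - k]
     steps. *)
  have := rmin (r - k); rewrite -{1}eq -iterD subnK ?er ?eqxx; [lia|lia].
have mk N : N < r -> (forall k, k < N -> (iter k g q < m) = (iter k g p < m)) ->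
   forall k, 0 < k <= N -> iter k g q != p /\ iter k g p != p.
  move=> Nr agr k kN; split; last by apply: noret => [|l lk]; [lia|apply: agr; lia].
  by apply/negP => /rmin; lia.
case: (boolP [exists k : 'I_r, (iter k g q < m) != (iter k g p < m)]) => ex.
  case/existsP: ex => k0 hk0.
  have ex : exists k, (iter k g q < m) != (iter k g p < m) by exists (k0 : nat).
  case: (ex_minnP ex) => N dN Nmin.
  have Nagr k : k < N -> (iter k g q < m) = (iter k g p < m).
    by move=> kN; apply: contraTeq kN => /Nmin; rewrite -leqNgt.
  have Nr : N < r by apply: leq_ltn_trans (Nmin _ hk0) (ltn_ord k0).
  exists N; split=> //; [exact: mk|exact: gE|by left; apply/eqP].
have agr k : k < r -> (iter k g q < m) = (iter k g p < m).
  move=> kr; apply: contraNeq ex => h; apply/existsP.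
  by exists (Ordinal kr).
(* Without a difference before step [r], the last common place is [r - 1], just before [q] arrives
   at [p]. *)
exists r.-1; rewrite prednK //; split.
- by move=> k kr; apply: agr; lia.
- by apply: mk => [|k kr]; [lia|apply: agr; lia].
- by apply: gE => k kr; apply: agr; lia.
- right; split=> //; first by apply: agr; lia.
    by apply: noret => //; lia.
  by rewrite gE // er.
Qed.

(** * Explicit positions in the order of the direct sum *)

Section Positions.
Variables (m1 n1 m2 n2 : nat).
Local Notation T := ('I_(m1 + n1) + 'I_(m2 + n2))%type.
Local Notation S := (min_ABS m1 n1 m2 n2).

Definition min_pos (t : T) : nat :=
  match t with
  | inl x => if x < n1 then x : nat else n2 + x
  | inr y => if y < n2 then n1 + y else m1 + n1 + y
  end.

Lemma index_min_order t : index t (min_order m1 n1 m2 n2) = min_pos t.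
Proof.
have take_enum N n (x : 'I_N) : (x \in take n (enum 'I_N)) = (x < n).
  by rewrite in_take ?mem_enum // index_enum_ord.
have index_take_enum N n (x : 'I_N) : x < n -> index x (take n (enum 'I_N)) = x.
  move=> xn; rewrite -[RHS]index_enum_ord -[in RHS](cat_take_drop n (enum 'I_N)).
  by rewrite index_cat take_enum xn.
have drop_enum N n (x : 'I_N) : n <= x -> x \in drop n (enum 'I_N).
  move=> nx; have := mem_enum 'I_N x; rewrite -{1}(cat_take_drop n (enum 'I_N)) mem_cat.
  by rewrite take_enum ltnNge nx.
have index_drop_enum N n (x : 'I_N) : n <= x -> index x (drop n (enum 'I_N)) = x - n.
  move=> nx; have := index_enum_ord x.
  rewrite -{1}(cat_take_drop n (enum 'I_N)) index_cat take_enum ltnNge nx /=.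
  by rewrite size_takel ?size_enum_ord; [lia|have := ltn_ord x; lia].
have inl_inj : injective (@inl 'I_(m1 + n1) 'I_(m2 + n2)) by move=> x y [].
have inr_inj : injective (@inr 'I_(m1 + n1) 'I_(m2 + n2)) by move=> x y [].
have lr (s : seq 'I_(m2 + n2)) (x : 'I_(m1 + n1)) : (inl x \in [seq inr y | y <- s]) = false.
  by apply/negP => /mapP[].
have rl (s : seq 'I_(m1 + n1)) (y : 'I_(m2 + n2)) : (inr y \in [seq inl x | x <- s]) = false.
  by apply/negP => /mapP[].
have s1 : size (take n1 (enum 'I_(m1 + n1))) = n1.
  by rewrite size_takel // size_enum_ord leq_addl.
have s2 : size (take n2 (enum 'I_(m2 + n2))) = n2.
  by rewrite size_takel // size_enum_ord leq_addl.
case: t => [x|y]; rewrite /min_order /= !index_cat ?lr ?rl ?mem_map // ?take_enum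
  ?size_map ?s1 ?s2 ?index_map //.
  case: ltnP => xn; first exact: index_take_enum.
  by rewrite drop_enum // index_drop_enum //; lia.
case: ltnP => yn; first by rewrite index_take_enum.
rewrite index_drop_enum // size_drop size_enum_ord; lia.
Qed.

Lemma min_ltE t u : abs_lt S t u = (min_pos t < min_pos u).
Proof. by rewrite /abs_lt /before !index_min_order. Qed.
End Positions.

(** * The minimal arrowed binary sequence *)

Section Minimal.
Variables (m1 n1 m2 n2 : nat) (i : 'I_(m1 + n1)) (j : 'I_(m2 + n2)).
Hypotheses (cop1 : coprime m1 n1) (cop2 : coprime m2 n2).
Hypotheses (mn1 : m1 < n1) (nm2 : n2 < m2).
Hypotheses (hi : m1 <= i < n1) (hj : j < m2).

Local Notation T := ('I_(m1 + n1) + 'I_(m2 + n2))%type.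
Local Notation S := (min_ABS m1 n1 m2 n2).
Local Notation a := (inl i : T).
Local Notation b := (inr j : T).
Local Notation delta := (abs_delta S).
Local Notation pi0 := (abs_pi S).
Local Notation pi := (small_mod pi0 a b).
Local Notation wlt := (word_lt delta pi).
Local Notation lt := (abs_lt S).
Local Notation rotA := (rot_pos m1 n1).
Local Notation rotB := (rot_pos m2 n2).

Definition atA (k : nat) (t : T) : bool := if t is inl x then x == k :> nat else false.
Definition atB (k : nat) (t : T) : bool := if t is inr y then y == k :> nat else false.

Lemma atA_inj k t u : atA k t -> atA k u -> t = u.
Proof. by case: t u => [x|//] [y|//] /eqP <- /eqP e; congr inl; apply: val_inj. Qed.

Lemma atB_inj k t u : atB k t -> atB k u -> t = u.
Proof. by case: t u => [//|x] [//|y] /eqP <- /eqP e; congr inr; apply: val_inj. Qed.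

Lemma atA_a : atA i a. Proof. exact: eqxx. Qed.
Lemma atB_b : atB j b. Proof. exact: eqxx. Qed.

Lemma deltaA k t : atA k t -> delta t = (k < m1).
Proof. by case: t => // x /eqP <-. Qed.

Lemma deltaB k t : atB k t -> delta t = (k < m2).
Proof. by case: t => // x /eqP <-. Qed.

Lemma atA_pi0 k t : atA k t -> atA (rotA k) (pi0 t).
Proof. by case: t => // x /eqP <-; rewrite permE /= permE /= rot_pos_mod. Qed.

Lemma atB_pi0 k t : atB k t -> atB (rotB k) (pi0 t).
Proof. by case: t => // x /eqP <-; rewrite permE /= permE /= rot_pos_mod. Qed.

(** [pi] departs from [pi0] on A only where the rotation would arrive at [i]; there the orbit passes
    to [b]. *)
Lemma atA_pi k t : atA k t -> if rotA k == i then pi t = b else atA (rotA k) (pi t).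
Proof.
move=> /atA_pi0; rewrite permM; case: ifP => [/eqP -> h|ki h].
  by rewrite (atA_inj h atA_a) tpermL.
by case: tpermP h => [->|->|//]; rewrite //= eq_sym ki.
Qed.

Lemma atB_pi k t : atB k t -> if rotB k == j then pi t = a else atB (rotB k) (pi t).
Proof.
move=> /atB_pi0; rewrite permM; case: ifP => [/eqP -> h|kj h].
  by rewrite (atB_inj h atB_b) tpermR.
by case: tpermP h => [->|->|//]; rewrite //= eq_sym kj.
Qed.

Lemma atA_iter n k t : atA k t -> (forall l, 0 < l <= n -> iter l rotA k != i) ->
  atA (iter n rotA k) (iter n pi t).
Proof.
move=> kt; elim: n => [//|n IH] h; rewrite !iterS.
have {}IH : atA (iter n rotA k) (iter n pi t) by apply: IH => l ln; apply: h; lia.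
by have := atA_pi IH; rewrite -iterS ifN //; apply: h; rewrite /= ltnSn.
Qed.

Lemma atB_iter n k t : atB k t -> (forall l, 0 < l <= n -> iter l rotB k != j) ->
  atB (iter n rotB k) (iter n pi t).
Proof.
move=> kt; elim: n => [//|n IH] h; rewrite !iterS.
have {}IH : atB (iter n rotB k) (iter n pi t) by apply: IH => l ln; apply: h; lia.
by have := atB_pi IH; rewrite -iterS ifN //; apply: h; rewrite /= ltnSn.
Qed.

Lemma atA_lt k t : atA k t -> k < m1 + n1.
Proof. by case: t => // x /eqP <-. Qed.

Lemma atB_lt k t : atB k t -> k < m2 + n2.
Proof. by case: t => // x /eqP <-. Qed.

Lemma at_cases t : (exists k, atA k t) \/ (exists k, atB k t).
Proof. by case: t => x; [left|right]; exists (x : nat); rewrite /= eqxx. Qed.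

Lemma posA k t : atA k t -> min_pos t = if k < n1 then k else n2 + k.
Proof. by case: t => // x /eqP <-. Qed.

Lemma posB k t : atB k t -> min_pos t = if k < n2 then n1 + k else m1 + n1 + k.
Proof. by case: t => // x /eqP <-. Qed.

(** [pi0] maps the zeros of A, the zeros of B, the ones of A and the ones of B increasingly onto the
    four successive blocks of the order. Since [m1 < n1] and [n2 < m2], zeros of A precede zeros of
    B, and ones of A precede ones of B. *)
Lemma min_pi_eq x y : delta x = delta y -> lt (pi0 x) (pi0 y) = lt x y.
Proof.
rewrite !min_ltE.
case: (at_cases x) => -[k kx]; case: (at_cases y) => -[l ly].
- rewrite (deltaA kx) (deltaA ly) (posA kx) (posA ly) (posA (atA_pi0 kx)) (posA (atA_pi0 ly)).
  have := atA_lt kx; have := atA_lt ly; rewrite /rot_pos.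
  by case: (ltnP k m1); case: (ltnP l m1); do ?case: ifP; lia.
- rewrite (deltaA kx) (deltaB ly) (posA kx) (posB ly) (posA (atA_pi0 kx)) (posB (atB_pi0 ly)).
  have := atA_lt kx; have := atB_lt ly; rewrite /rot_pos.
  by case: (ltnP k m1); case: (ltnP l m2); do ?case: ifP; lia.
- rewrite (deltaB kx) (deltaA ly) (posB kx) (posA ly) (posB (atB_pi0 kx)) (posA (atA_pi0 ly)).
  have := atB_lt kx; have := atA_lt ly; rewrite /rot_pos.
  by case: (ltnP k m2); case: (ltnP l m1); do ?case: ifP; lia.
- rewrite (deltaB kx) (deltaB ly) (posB kx) (posB ly) (posB (atB_pi0 kx)) (posB (atB_pi0 ly)).
  have := atB_lt kx; have := atB_lt ly; rewrite /rot_pos.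
  by case: (ltnP k m2); case: (ltnP l m2); do ?case: ifP; lia.
Qed.

Lemma min_pi_01 x y : ~~ delta x -> delta y -> lt (pi0 x) (pi0 y).
Proof.
rewrite !min_ltE.
case: (at_cases x) => -[k kx]; case: (at_cases y) => -[l ly].
- rewrite (deltaA kx) (deltaA ly) (posA (atA_pi0 kx)) (posA (atA_pi0 ly)).
  have := atA_lt kx; have := atA_lt ly; rewrite /rot_pos.
  by case: (ltnP k m1); case: (ltnP l m1); do ?case: ifP; lia.
- rewrite (deltaA kx) (deltaB ly) (posA (atA_pi0 kx)) (posB (atB_pi0 ly)).
  have := atA_lt kx; have := atB_lt ly; rewrite /rot_pos.
  by case: (ltnP k m1); case: (ltnP l m2); do ?case: ifP; lia.
- rewrite (deltaB kx) (deltaA ly) (posB (atB_pi0 kx)) (posA (atA_pi0 ly)).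
  have := atB_lt kx; have := atA_lt ly; rewrite /rot_pos.
  by case: (ltnP k m2); case: (ltnP l m1); do ?case: ifP; lia.
- rewrite (deltaB kx) (deltaB ly) (posB (atB_pi0 kx)) (posB (atB_pi0 ly)).
  have := atB_lt kx; have := atB_lt ly; rewrite /rot_pos.
  by case: (ltnP k m2); case: (ltnP l m2); do ?case: ifP; lia.
Qed.

Lemma lt_ab : lt a b.
Proof. rewrite min_ltE (posA atA_a) (posB atB_b); do ?case: ifP; lia. Qed.

(** [a] lies in the first block; a zero of the third block precedes [b] only if [b] lies in the
    fourth, that is, if [n2 <= j]. *)
Lemma zero_betweenA k t : atA k t ->
  [&& ~~ delta t, lt a t & lt t b] = (i < k) && ((k < n1) || (n2 <= j)).
Proof.
move=> kt; rewrite !min_ltE (deltaA kt) (posA kt) (posA atA_a) (posB atB_b).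
have := atA_lt kt; case: (ltnP i n1); case: (ltnP k n1); case: (ltnP j n2); lia.
Qed.

Lemma zero_betweenB k t : atB k t -> [&& ~~ delta t, lt a t & lt t b] = false.
Proof.
move=> kt; rewrite !min_ltE (deltaB kt) (posB kt) (posA atA_a) (posB atB_b).
have := atB_lt kt; case: (ltnP i n1); case: (ltnP k n2); case: (ltnP j n2); lia.
Qed.

Lemma one_betweenA k t : atA k t -> [&& delta t, lt a t & lt t b] = false.
Proof.
move=> kt; rewrite !min_ltE (deltaA kt) (posA kt) (posA atA_a) (posB atB_b).
have := atA_lt kt; case: (ltnP i n1); case: (ltnP k n1); case: (ltnP j n2); lia.
Qed.

Lemma one_betweenB k t : atB k t -> [&& delta t, lt a t & lt t b] = (k < j).
Proof.
move=> kt; rewrite !min_ltE (deltaB kt) (posB kt) (posA atA_a) (posB atB_b).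
have := atB_lt kt; case: (ltnP i n1); case: (ltnP k n2); case: (ltnP j n2); lia.
Qed.

(** While the digits agree, the orbit of [z] stays at distance [k - i] to the right of that of [a].
    As ones come first in A, the first difference shows 0 for [z] and 1 for [a]. The alternative is
    that [z] reaches the preimage of [b] first. *)
Lemma zero_first_difference k z : i < k -> atA k z -> exists N,
  [/\ forall l, l <= N -> (exists k', atA k' (iter l pi z)) /\
        (exists k', atA k' (iter l pi a)),
      forall l, l < N -> delta (iter l pi z) = delta (iter l pi a)
    & (~~ delta (iter N pi z) /\ delta (iter N pi a)) \/
      [/\ delta (iter N pi z) = delta (iter N pi a), iter N.+1 pi z = b
        & exists k', atA k' (iter N.+1 pi a)]].
Proof.
move=> ik kz.
have [|N [agr ret dN last]] := rot_pos_first_difference cop1 (ltn_ord i) (atA_lt kz).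
  by rewrite neq_ltn ik.
have pz l : l <= N -> atA (iter l rotA k) (iter l pi z).
  by move=> lN; apply: atA_iter => // l' l'l; apply: (ret l' _).1; lia.
have pa l : l <= N -> atA (iter l rotA i) (iter l pi a).
  by move=> lN; apply: (atA_iter atA_a) => l' l'l; apply: (ret l' _).2; lia.
exists N; split.
- by move=> l lN; split; eexists; [exact: pz|exact: pa].
- by move=> l lN; rewrite (deltaA (pz l (ltnW lN))) (deltaA (pa l (ltnW lN))) agr.
- rewrite (deltaA (pz N _)) // (deltaA (pa N _)) //.
  case: last => [neq|[eqN ez ea _]]; first by left; move: neq; do ?case: ifP; lia.
  right; split=> //.
    by have := atA_pi (pz N (leqnn N)); rewrite -iterS ez eqxx.
  exists (iter N.+1 rotA i).
  by have := atA_pi (pa N (leqnn N)); rewrite -iterS ifN.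
Qed.

(** The mirror image in B. The equation for [k'] records that the orbit of [b] is still shifted by
    [j - k] when [w] would arrive at position [j]. *)
Lemma one_first_difference k w : k < j -> atB k w -> exists N,
  [/\ forall l, l <= N -> exists k', atB k' (iter l pi w),
      forall l, l < N -> delta (iter l pi w) = delta (iter l pi b)
    & (delta (iter N pi w) /\ ~~ delta (iter N pi b)) \/
      [/\ delta (iter N pi w) = delta (iter N pi b), iter N.+1 pi w = a
        & exists k', atB k' (iter N.+1 pi b) /\ k' + k = j + j]].
Proof.
move=> kj kw.
have [|N [agr ret dN last]] := rot_pos_first_difference cop2 (ltn_ord j) (atB_lt kw).
  by rewrite neq_ltn kj orbT.
have pw l : l <= N -> atB (iter l rotB k) (iter l pi w).
  by move=> lN; apply: atB_iter => // l' l'l; apply: (ret l' _).1; lia.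
have pb l : l <= N -> atB (iter l rotB j) (iter l pi b).
  by move=> lN; apply: (atB_iter atB_b) => l' l'l; apply: (ret l' _).2; lia.
exists N; split.
- by move=> l lN; eexists; exact: pw.
- by move=> l lN; rewrite (deltaB (pw l (ltnW lN))) (deltaB (pb l (ltnW lN))) agr.
- rewrite (deltaB (pw N _)) // (deltaB (pb N _)) //.
  case: last => [neq|[eqN ew eb db]]; first by left; move: neq; do ?case: ifP; lia.
  right; split=> //.
    by have := atB_pi (pw N (leqnn N)); rewrite -iterS ew eqxx.
  exists (iter N.+1 rotB j); split=> //.
  by have := atB_pi (pb N (leqnn N)); rewrite -iterS ifN.
Qed.

Section Separated.
Hypothesis separatedA : forall k t, atA k t -> i < k -> (k < n1) || (n2 <= j) -> wlt t a.
Hypothesis separatedB : forall k t, atB k t -> k < j -> wlt b t.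

(* Both words must start with 1.  A 1 of A is followed by a 0, so both continue by 0;
   a 0 of B is followed by a 1, so both continue by 1, and the position of [t] has
   decreased by m2 - n2.  If one of the orbits leaves its component before, it does
   so at [a] or [b], and the section hypotheses apply. *)
Lemma word_lt_BA k l t u : atB k t -> k <= j -> atA l u -> ~ wlt t u.
Proof.
move=> + + + [d [agr dt du]].
elim/ltn_ind: d k l t u agr dt du => d IH k l t u agr dt du kt kj lu.
have dt0 : delta t by rewrite (deltaB kt); lia.
case: d IH agr dt du => [|d] IH agr dt du; first by case/negP: dt; exact: dt0.
have wpi : wlt (pi t) (pi u).
  exists d; rewrite -!iterSr; split=> // r rd; rewrite -!iterSr; exact: agr.
have lm : l < m1 by have : delta t = delta u := agr 0 (ltn0Sn d); rewrite dt0 (deltaA lu).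
(* [l + n1] exceeds [i], so this step stays in A. *)
have := atA_pi lu; rewrite /rot_pos lm ifN; last by lia.
have km2 : k < m2 by lia.
move=> lu1; have := atB_pi kt; rewrite /rot_pos km2.
case: eqP => [kj1 ea|kj1 kt1].
  (* Here [j = k + n2], whence the side condition [n2 <= j]. *)
  apply: (word_lt_asym wpi); rewrite ea; apply: separatedA lu1 _ _; first by lia.
  by rewrite -kj1 leq_addl orbT.
have du1 : ~~ delta (pi u) by rewrite (deltaA lu1) -leqNgt; move: mn1; clear; lia.
case: d IH agr dt du wpi => [|d] IH agr dt du wpi; first by case/negP: du1; exact: du.
have dt1 : ~~ delta (pi t) by have -> : delta (pi t) = delta (pi u) := agr 1 isT.
have km : m2 <= k + n2 by move: dt1; rewrite (deltaB kt1) -leqNgt.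
have wpi2 : wlt (pi (pi t)) (pi (pi u)).
  exists d; rewrite -!iterSr; split=> // r rd; rewrite -!iterSr; exact: agr.
have km' : (k + n2 < m2) = false by rewrite ltnNge km.
have kj2 : k + n2 - m2 < j by move: km kj nm2; clear; lia.
have kj' : (k + n2 - m2 == j) = false by rewrite ltn_eqF.
have lm' : (l + n1 < m1) = false by move: mn1; clear; lia.
have := atB_pi kt1; rewrite /rot_pos km' kj' => kt2.
have := atA_pi lu1; rewrite /rot_pos lm'.
case: ifP => [_ eb|_ lu2].
  by apply: (word_lt_asym wpi2); rewrite eb; exact: separatedB kt2 kj2.
apply: (IH d _ _ _ _ _ _ _ _ kt2 _ lu2) => //; rewrite -?iterSr //; last exact: ltnW.
by move=> r rd; rewrite -!iterSr; apply: agr.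
Qed.
End Separated.

(** * Hits and word inequalities *)

Local Notation Z := (zeros_between S a b).
Local Notation W := (ones_between S a b).

Lemma in_zeros_betweenP z : z \in Z -> exists2 k, atA k z & i < k.
Proof.
rewrite inE; case: (at_cases z) => -[k kz]; last by rewrite (zero_betweenB kz).
by rewrite (zero_betweenA kz) => /andP[ik _]; exists k.
Qed.

Lemma in_ones_betweenP w : w \in W -> exists2 k, atB k w & k < j.
Proof.
rewrite inE; case: (at_cases w) => -[k kw]; first by rewrite (one_betweenA kw).
by rewrite (one_betweenB kw) => kj; exists k.
Qed.

Lemma zeros_between_inl z : z \in Z -> is_inl z.
Proof. by case/in_zeros_betweenP => k; case: z. Qed.

Lemma ones_between_inr w : w \in W -> ~~ is_inl w.
Proof. by case/in_ones_betweenP => k; case: w. Qed.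

Lemma pi0_inl t : is_inl (pi0 t) = is_inl t.
Proof. by case: t => x; rewrite permE. Qed.

Lemma delta_a : ~~ delta a.
Proof. by rewrite (deltaA atA_a) -leqNgt; case/andP: hi. Qed.

Lemma delta_b : delta b.
Proof. by rewrite (deltaB atB_b). Qed.

Let runA := agreeing_images delta pi a Z.

Lemma zeros_between_delta z : z \in Z -> delta z = delta a.
Proof. by rewrite inE => /and3P[dz _ _]; rewrite (negbTE dz) (negbTE delta_a). Qed.

Lemma ones_between_delta w : w \in W -> delta w = delta b.
Proof. by rewrite inE => /and3P[-> _ _]; rewrite delta_b. Qed.

Let hit_intro x0 (X : {set T}) c N z : z \in X ->
  (forall l, l <= N -> delta (iter l pi z) = delta (iter l pi x0)) ->
  iter N.+1 pi z = c -> [exists t in agreeing_images delta pi x0 X N, pi t == c].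
Proof.
move=> zX agr ez; apply/exists_inP; exists (iter N pi z); last by rewrite -ez iterS.
by apply/agreeing_imagesP; exists z => //; split=> // l /andP[_]; exact: agr.
Qed.

Let hit_elim x0 (X : {set T}) c n : (forall z, z \in X -> delta z = delta x0) ->
  [exists t in agreeing_images delta pi x0 X n, pi t == c] -> exists z, [/\ z \in X,
  (forall l, l <= n -> delta (iter l pi z) = delta (iter l pi x0))
  & iter n.+1 pi z = c].
Proof.
move=> dX /exists_inP[t /agreeing_imagesP[z zX [-> agr]] /eqP ez]; exists z; split=> // -[_|l ln].
  exact: dX.
exact: agr.
Qed.

Let inl_at k t : atA k t -> is_inl t. Proof. by case: t. Qed.
Let inr_at k t : atB k t -> ~~ is_inl t. Proof. by case: t. Qed.

(** Agreement through place [n] either ends within the path inside A or continues until [z] reaches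
    [b], which is an earlier hit. *)
Lemma alpha_inl n t : (forall k, k < n -> ~~ hitA S a b k) -> t \in runA n ->
  is_inl (iter n pi a).
Proof.
move=> nh /agreeing_imagesP[z zZ [_ agr]]; have [k kz ik] := in_zeros_betweenP zZ.
have agr' l : l <= n -> delta (iter l pi z) = delta (iter l pi a).
  by case: l => [_|l ln]; [exact: zeros_between_delta|exact: agr].
have [N [path agrN last]] := zero_first_difference ik kz.
case: (leqP n N) => nN.
  by have [_ [k' /inl_at]] := path n nN.
case: last => [[dz da]|[eqN ez _]].
  by move: dz; rewrite agr' ?da // ltnW.
case/negP: (nh N nN); apply: hit_intro zZ _ ez => l lN; apply: agr'; lia.
Qed.

Definition words_separated := forall t, lt a t -> lt t b ->
  if delta t then wlt b t else wlt t a.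

Let separatedA k t : words_separated -> atA k t -> i < k -> (k < n1) || (n2 <= j) -> wlt t a.
Proof.
move=> g kt ik kn; have := zero_betweenA kt; rewrite ik kn => /and3P[dt at_ tb].
by have := g t at_ tb; rewrite (negbTE dt).
Qed.

Let separatedB k t : words_separated -> atB k t -> k < j -> wlt b t.
Proof.
move=> g kt kj; have := one_betweenB kt; rewrite kj => /and3P[dt at_ tb].
by have := g t at_ tb; rewrite dt.
Qed.

(** A digit difference precludes a hit, since the orbit of [z] is in A until then. Otherwise,
    dropping the common prefix from the inequality of [z] and [a] makes the word of [b] smaller than
    that of an element of A, contradicting [word_lt_BA]. *)
Lemma separated_no_hitA n : words_separated -> ~~ hitA S a b n.
Proof.
move=> g; apply/negP => /(hit_elim zeros_between_delta)[z [zZ agr ez]].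
have [k kz ik] := in_zeros_betweenP zZ.
have [N [path agrN last]] := zero_first_difference ik kz.
case: last => [[dz da]|[eqN ezN [k' ka]]].
  have nN : n < N by rewrite ltnNge; apply/negP => /agr e; move: dz; rewrite e da.
  by have [[k' /inl_at]] := path _ nN; rewrite ez.
have zlta : wlt z a.
  move: zZ; rewrite inE => /and3P[dz az zb].
  by have := g z az zb; rewrite (negbTE dz).
have agr1 l : l < N.+1 -> delta (iter l pi z) = delta (iter l pi a).
  by rewrite ltnS leq_eqVlt => /predU1P[->|/agrN].
move/(word_lt_iter agr1): zlta; rewrite ezN.
apply: word_lt_BA atB_b (leqnn _) ka.
  by move=> ? ? /(separatedA g); apply.
by move=> ? ? /(separatedB g); apply.
Qed.

Lemma separated_no_hitB n : words_separated -> ~~ hitB S a b n.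
Proof.
move=> g; have gA k t (h : atA k t) := separatedA g h.
have gB k t (h : atB k t) := separatedB g h.
apply/negP => /(hit_elim ones_between_delta)[w [wW agr ew]].
have [k kw kj] := in_ones_betweenP wW.
have [N [path agrN last]] := one_first_difference kj kw.
case: last => [[dw db]|[eqN ewN [k' [kb ek]]]].
  have nN : n < N by rewrite ltnNge; apply/negP => /agr e; move: db; rewrite -e dw.
  by have [k' /inr_at] := path _ nN; rewrite ew.
have agr1 l : l < N.+1 -> delta (iter l pi b) = delta (iter l pi w).
  by rewrite ltnS leq_eqVlt => /predU1P[->|/agrN].
move/(word_lt_iter agr1): (gB _ _ kw kj); rewrite ewN.
set t := iter N.+1 pi b in kb * => wta.
(* As [k' = 2j - k] exceeds [j], [word_lt_BA] does not apply to [t] itself. If [t] is a one, first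
   digits decide; if a zero, one more step brings it to [k' - m2 < j]. *)
case: (ltnP k' m2) => km.
  apply: (word_lt_asym wta); apply: word_lt01 delta_a _.
  by rewrite (deltaB kb).
have dt : delta t = delta a.
  by rewrite (deltaB kb) (negbTE delta_a) ltnNge km.
move/(word_lt_step pi dt): wta => wta.
have k'j : k' - m2 < j by move: ek kj hj km; clear; lia.
have := atB_pi kb; rewrite /rot_pos ltnNge km /= ltn_eqF // => kt.
have := atA_pi atA_a; rewrite /rot_pos ltnNge (andP hi).1 /=.
(* The rotation fixes [i] when [m1 = 0], and then [pi a = b]. *)
case: ifP => [_ ea|_ ka].
  by apply: (word_lt_asym wta); rewrite ea; exact: gB kt k'j.
exact: (word_lt_BA gA gB kt (ltnW k'j) ka wta).
Qed.

(** The first difference always has the required sign; the only alternative is a hit. *)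
Lemma no_hit_separated :
  (forall n, ~~ hitA S a b n) -> (forall n, ~~ hitB S a b n) -> words_separated.
Proof.
move=> nhA nhB t at_ tb; case: (boolP (delta t)) => dt.
  have tW : t \in W by rewrite inE dt at_.
  have [k kt kj] := in_ones_betweenP tW.
  have [N [_ agr [[dw db]|[eqN ew _]]]] := one_first_difference kj kt.
    by exists N; split=> // l lN; rewrite agr.
  case/negP: (nhB N); apply: hit_intro tW _ ew => l.
  by rewrite leq_eqVlt => /predU1P[->|/agr].
have tZ : t \in Z by rewrite inE dt at_.
have [k kt ik] := in_zeros_betweenP tZ.
have [N [_ agr [[dz da]|[eqN ez _]]]] := zero_first_difference ik kt; first by exists N.
case/negP: (nhA N); apply: hit_intro tZ _ ez => l.
by rewrite leq_eqVlt => /predU1P[->|/agr].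
Qed.

(** Without hits every [z] in [Z] differs from [a] at some place; the maximum of these places over
    [Z] empties the run. *)
Lemma runA_stops : (forall n, ~~ hitA S a b n) -> exists c, runA c = finset.set0.
Proof.
move=> nhA.
have differ (z : T) : exists N, z \in Z -> delta (iter N pi z) != delta (iter N pi a).
  case: (boolP (z \in Z)) => zZ; last by exists 0.
  have [k kz ik] := in_zeros_betweenP zZ.
  have [N [_ agr [[dz da]|[eqN ez _]]]] := zero_first_difference ik kz.
    by exists N => _; rewrite (negbTE dz) da.
  case/negP: (nhA N); apply: hit_intro zZ _ ez => l.
  by rewrite leq_eqVlt => /predU1P[->|/agr].
have [f fP] := fin_all_exists differ.
exists (\max_z f z); apply/setP => t; rewrite inE; apply/negP => /agreeing_imagesP[z zZ [_ agr]].
(* Place 0 must be excluded, since the runs do not test it; there the digits agree. *)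
have := fP z zZ; case e : (f z) => [|N].
  by case/eqP; exact: zeros_between_delta.
rewrite -e agr ?eqxx // {1}e /=; exact: (leq_bigmax (F := f)).
Qed.

Lemma separated_no_in_cal : words_separated <-> ~ exists n,
  in_calA S a b n (pi^-1 b)%g \/ in_calB S a b n (pi^-1 a)%g.
Proof.
have inl_a : is_inl a by [].
have inr_b : ~~ is_inl b by [].
rewrite (in_cal_hit min_pi_eq min_pi_01 delta_a delta_b lt_ab zeros_between_inl
  ones_between_inr pi0_inl inl_a inr_b alpha_inl runA_stops).
split=> [g [n]|nh].
  by rewrite (negbTE (separated_no_hitA n g)) (negbTE (separated_no_hitB n g)).
apply: no_hit_separated => n; apply/negP => h; apply: nh; exists n; rewrite h //.
by rewrite orbT.
Qed.

Lemma length_drop (lt' : rel T) : strict_total lt' ->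
  (forall x y, delta x = delta y -> lt' (pi x) (pi y) = lt' x y) ->
  (forall x y, ~~ delta x -> delta y -> lt' (pi x) (pi y)) ->
  (\sum_(p | ~~ delta p.1 && delta p.2) (lt' p.1 p.2)%:Z = (abs_length S)%:Z - 1)%R
  <-> ~ exists n, in_calA S a b n (pi^-1 b)%g \/ in_calB S a b n (pi^-1 a)%g.
Proof.
move=> so' lt'_eq lt'_01; rewrite -separated_no_in_cal abs_lengthE.
apply: (exchange_length _ so' min_pi_eq min_pi_01 lt'_eq lt'_01 delta_a delta_b lt_ab).
by apply: strict_total_before => x; rewrite (perm_mem (abs_orderP S)) mem_enum.
Qed.
End Minimal.

(** * Slopes and the length criterion *)

Lemma slope_lt_half m n : 0 < m + n -> (slope m n < 1 / 2)%R = (n < m).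
Proof.
move=> h0; rewrite /slope ltr_pdivrMr ?ltr0n // -(ltr_nat rat) natrD.
by apply/idP/idP; lra.
Qed.

Lemma slope_gt_half m n : 0 < m + n -> (1 / 2 < slope m n)%R = (m < n).
Proof.
move=> h0; rewrite /slope ltr_pdivlMr ?ltr0n // -(ltr_nat rat) natrD.
by apply/idP/idP; lra.
Qed.

Unset Implicit Arguments.
Local Open Scope ring_scope.

(* The paper's indices are i.+1 and j.+1: the ordinal i encodes the element
   of A in position i.+1, and likewise for j and B. *)
Theorem theorem4p1 (R : realType) (m1 n1 m2 n2 : nat)
    (cop1 : coprime m1 n1) (cop2 : coprime m2 n2)
    (slopes : slope m2 n2 < 1 / 2 < slope m1 n1)
    (i : 'I_(m1 + n1)) (j : 'I_(m2 + n2))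
    (hi : (m1 < i.+1 <= n1)%N) (hj : (1 <= j.+1 <= m2)%N)
    (S' : ABS ('I_(m1 + n1) + 'I_(m2 + n2))%type) :
  let S := min_ABS m1 n1 m2 n2 in
  let zeroA := inl i in
  let oneB := inr j in
  let pi := small_mod (abs_pi S) zeroA oneB in
  is_specialization R S pi S' ->
  ((abs_length S')%:Z = (abs_length S)%:Z - 1
   <->
   ~ exists n : nat,
       in_calA S zeroA oneB n ((pi^-1)%g oneB)
       \/ in_calB S zeroA oneB n ((pi^-1)%g zeroA)).
Proof.
move=> S zeroA oneB pi spec.
have [nm2 mn1] : (n2 < m2)%N /\ (m1 < n1)%N.
  move: slopes; rewrite slope_lt_half ?slope_gt_half; first by case/andP.
    exact: leq_ltn_trans (leq0n i) (ltn_ord i).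
  exact: leq_ltn_trans (leq0n j) (ltn_ord j).
have hj' : (j < m2)%N by case/andP: hj.
have [so' lt'_eq lt'_01] := specialization_order spec.
rewrite (abs_lengthE S'); have -> : abs_delta S' = abs_delta S by case: spec.
exact: length_drop.
Qed.
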